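(* Let $G$ be a discrete group. The following hold true: (i) If $\varphi\in\triangle(\mathrm{B}(G))\setminus G$, then $\varphi(f)=0$ for every $f\in \mathrm{B}_{0}(G)\cap \mathrm{NS}(G)$. (ii) $\mathrm{B}_{0}(G)\cap \mathrm{NS}(G)$ is a closed ideal in $\mathrm{B}(G)$. (iii) $\triangle(\mathrm{B}_{0}(G)\cap \mathrm{NS}(G))=G$.
   Context: For a discrete group $G$, $\mathrm{B}(G)$ is the Fourier--Stieltjes algebra: the linear span of positive definite functions on $G$, a commutative unital Banach algebra under pointwise multiplication with the norm of $\mathrm{B}(G)=C^{\ast}(G)^{\ast}$ (dual of the full group $C^*$-algebra). $\mathrm{B}_{0}(G):=\mathrm{B}(G)\cap c_{0}(G)$. $\sigma(f)$ is the spectrum of $f$ in $\mathrm{B}(G)$, and $\mathrm{NS}(G)=\{f\in\mathrm{B}(G):\sigma(f)=\overline{f(G)}\}$. For a commutative Banach algebra $A$, $\triangle(A)$ is the set of (nonzero) multiplicative linear functionals on $A$ with the weak$^*$ topology. The group $G$ is identified with the set of point evaluations $f\mapsto f(x)$, $x\in G$; thus (iii) says that the multiplicative linear functionals on $\mathrm{B}_{0}(G)\cap \mathrm{NS}(G)$ are exactly the point evaluations at elements of $G$. *)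

(* Defs.v *)
From HB Require Import structures.
From mathcomp Require Import all_boot all_order all_algebra finmap.
From mathcomp Require Import complex.
From mathcomp Require Import all_classical all_reals all_analysis.

Set Implicit Arguments.
Unset Strict Implicit.
Unset Printing Implicit Defensive.

Import Order.TTheory GRing.Theory Num.Theory.
Import numFieldNormedType.Exports.

Local Open Scope classical_set_scope.
Local Open Scope ring_scope.

Definition positive_definite (R : realType) (G : groupType)
    (phi : G -> R[i]) : Prop :=
  forall (n : nat) (x : 'I_n -> G) (c : 'I_n -> R[i]),
    0 <= \sum_(i < n) \sum_(j < n) Num.conj (c i) * c j * phi ((x i)^-1 * x j)%g.

(* B(G) *)
Definition fourier_stieltjes (R : realType) (G : groupType) :
    set (G -> R[i]) :=
  [set f | exists n (c : 'I_n -> R[i]) (phi : 'I_n -> G -> R[i]),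
    (forall i, positive_definite (phi i)) /\
    f = (fun x => \sum_(i < n) c i * phi i x)].
Arguments fourier_stieltjes R G _ : clear implicits.

(* c_0(G): vanishing at infinity, where compact subsets of the discrete
   space G are the finite ones *)
Definition c0 (R : realType) (G : groupType) : set (G -> R[i]) :=
  [set f | forall e : R[i], 0 < e -> finite_set [set x | e <= `|f x|]].
Arguments c0 R G _ : clear implicits.

(* B_0(G) *)
Definition fourier_stieltjes0 (R : realType) (G : groupType) :
    set (G -> R[i]) :=
  fourier_stieltjes R G `&` c0 R G.
Arguments fourier_stieltjes0 R G _ : clear implicits.

(* sigma(f), the spectrum of f in the unital algebra B(G); the operations on
   G -> R[i] are pointwise *)
Definition spectrum (R : realType) (G : groupType) (f : G -> R[i]) :
    set R[i] :=
  [set l | ~ exists2 g, fourier_stieltjes R G g & (f - cst l) * g = cst 1].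

(* NS(G); R[i]^o carries the topology of the modulus *)
Definition natural_spectrum (R : realType) (G : groupType) :
    set (G -> R[i]) :=
  [set f | fourier_stieltjes R G f /\
           spectrum f = closure (range f : set R[i]^o)].
Arguments natural_spectrum R G _ : clear implicits.

(* Norms of normed spaces over R[i] take their values in R[i]. *)
Definition rnorm (R : realType) (V : normedZmodType R[i]) (v : V) : R :=
  complex.Re `|v|.

Record hilbert (R : realType) := Hilbert {
  hilbert_space :> completeNormedModType R[i];
  inner : {dot hilbert_space for Num.conj};
  innerE : forall v, inner v v = `|v| ^+ 2
}.

Record unitary_rep (R : realType) (G : groupType) := UnitaryRep {
  rep_space : hilbert R;
  rep_act :> G -> {linear rep_space -> rep_space};
  rep_act1 : forall v, rep_act 1%g v = v;
  rep_actM : forall x y v, rep_act (x * y)%g v = rep_act x (rep_act y v);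
  rep_unitary : forall x u v,
    inner rep_space (rep_act x u) (rep_act x v) = inner rep_space u v
}.

(* The norm on the group algebra C[G] (finitely supported functions) whose
   completion is the full group C*-algebra: the supremum over all unitary
   representations pi of the operator norms of pi(c) = sum_x c(x) pi(x). *)
Definition cstar_norm (R : realType) (G : groupType)
    (c : {fsfun G -> R[i] with 0}) : \bar R :=
  ereal_sup [set r | exists (pi : unitary_rep R G) (v : rep_space pi),
    `|v| <= 1 /\ r = (rnorm (\sum_(x <- finsupp c) c x *: pi x v))%:E].

(* The norm of B(G) = C*(G)^*: f corresponds to the functional extending
   c |-> sum_x c(x) f(x), whose norm can be computed on the dense subalgebra
   C[G] of C*(G). *)
Definition fs_norm (R : realType) (G : groupType) (f : G -> R[i]) : \bar R :=
  ereal_sup [set (rnorm (\sum_(x <- finsupp c) c x * f x))%:E |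
    c in [set c : {fsfun G -> R[i] with 0} | (cstar_norm c <= 1)%E]].

Definition ideal (R : realType) (G : groupType) (I : set (G -> R[i])) : Prop :=
  [/\ I `<=` fourier_stieltjes R G,
      I (cst 0),
      forall a f g, I f -> I g -> I (a *: f + g)
    & forall f g, fourier_stieltjes R G f -> I g -> I (f * g)].

Definition norm_closed (R : realType) (G : groupType)
    (I : set (G -> R[i])) : Prop :=
  forall f, fourier_stieltjes R G f ->
    (forall e : R, 0 < e -> exists2 g, I g & (fs_norm (f - g)%R < e%:E)%E) ->
    I f.

(* Delta(A) for an algebra A of functions on G, as a set of functionals A -> C.
   Linearity and multiplicativity are stated through the values of elements of
   A, so that no proof that A is a subalgebra is needed to form Delta(A). *)
Definition Delta (R : realType) (G : groupType) (A : set (G -> R[i])) :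
    set (A -> R[i]) :=
  [set chi |
    [/\ forall (a : R[i]) (f g h : A),
          val h = a *: val f + val g -> chi h = a * chi f + chi g,
        forall f g h : A, val h = val f * val g -> chi h = chi f * chi g
      & exists f, chi f != 0]].
Arguments Delta {R G} A _.

Definition point_eval (R : realType) (G : groupType) (A : set (G -> R[i]))
    (x : G) : A -> R[i] :=
  fun f => val f x.
Arguments point_eval {R G} A x _.

(* Main.v *)
(* Let [D_r] be the set of all [sum_{k<4} i^k phi_k] with [phi_k] positive
   definite and [sum_k phi_k(1) <= r]; it is the [r]-ball of a norm equivalent
   to that of B(G), it is multiplicative, and it is closed for pointwise
   convergence. An element of B(G) belongs to B_0(G) and to NS(G) if and only if
   it is quasinilpotent in the quotient of B(G) by the ideal of finitely
   supported functions; these elements form a closed ideal, and they are killed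
   by every character that vanishes on all point masses, i.e. that is not a
   point evaluation.

   If [f] is quasinilpotent modulo finitely supported functions, the Neumann
   series inverts [f - l] up to a finite set as soon as [l <> 0]. Conversely,
   for [f] in c_0(G) with natural spectrum, only finitely many values of [f] lie
   outside a small circle, and the resolvent exists on that circle; Cauchy's
   formula then expresses [f^n], restricted to the complement of a finite set,
   through the resolvent, which bounds its norm. The contour integral is
   replaced by means over [2^k]-th roots, whose pointwise limit stays in [D_r].

   The norm of C*(G)^* enters only through the inclusion in [D_r] of its ball of
   radius [r/4]: a function outside [D_r] is separated from [D_r] by an element
   of C[G] whose numerical radius in every unitary representation is controlled
   by its values on positive definite functions. *)
Require Import Defs.
From HB Require Import structures.
From mathcomp Require Import all_boot all_order all_algebra finmap.
From mathcomp Require Import complex ring lra.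
From mathcomp Require Import all_classical all_reals all_analysis.
Import Order.TTheory GRing.Theory Num.Theory.
Import numFieldNormedType.Exports.
Local Open Scope classical_set_scope.
Local Open Scope ring_scope.

Set Implicit Arguments.
Unset Strict Implicit.

(** * Positive definite functions *)

Section PositiveDefinite.
Local Open Scope sesquilinear_scope.
Variables (R : realType) (G : groupType).
Local Notation C := R[i].
Implicit Types (phi psi : G -> C) (x y : G).

Lemma positive_definite_fin (T : finType) phi (x : T -> G) (c : T -> C) :
  positive_definite phi ->
  0 <= \sum_s \sum_t (c s)^* * c t * phi ((x s)^-1 * x t)%g.
Proof.
move=> phiP.
have := phiP #|T| (fun i => x (enum_val i)) (fun i => c (enum_val i)).
congr (0 <= _).
have eT : {on [pred _ | true], bijective (@enum_val T predT)}.
  exact/onW_bij/enum_val_bij.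
rewrite [RHS](reindex _ eT); apply: eq_bigr => i _.
by rewrite [RHS](reindex _ eT).
Qed.

(** The form at the points [1] and [x]: suitable [a] and [b] give both the hermitian symmetry and
    the bound by the value at [1]. *)
Lemma positive_definite_pair phi x (a b : C) : positive_definite phi ->
  0 <= (`|a| ^+ 2 + `|b| ^+ 2) * phi 1%g
       + (a^* * b * phi x + b^* * a * phi (x^-1)%g).
Proof.
move=> phiP.
have := phiP 2%N (fun i => if i == ord0 then 1%g else x)
             (fun i => if i == ord0 then a else b).
rewrite !big_ord_recl !big_ord0 /=.
rewrite !invg1 !mul1g mulg1 mulVg !addr0.
by rewrite !normCK; congr (0 <= _); ring.
Qed.

Lemma positive_definite1_ge0 phi : positive_definite phi -> 0 <= phi 1%g.
Proof.
move=> /(positive_definite_pair 1%g 1 0); congr (0 <= _).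
by rewrite rmorph0 normr0 normr1; ring.
Qed.

Lemma positive_definiteV phi x :
  positive_definite phi -> phi (x^-1)%g = (phi x)^*.
Proof.
move=> phiP.
have p1R : phi 1%g \is Num.real.
  exact: ger0_real (positive_definite1_ge0 phiP).
have aR (a b : C) : (`|a| ^+ 2 + `|b| ^+ 2) * phi 1%g \is Num.real.
  by rewrite realM// realD// realX// normr_real.
(* The weights (1, 1) and (1, i) show that the sum of the two values, and i times their difference,
   are real; together these identify one value as the conjugate of the other. *)
have S : phi x + phi x^-1%g \is Num.real.
  have /ger0_real := positive_definite_pair x 1 1 phiP.
  by rewrite rpredDl// rmorph1 !mul1r.
have D : 'i * (phi x - phi x^-1%g) \is Num.real.
  have /ger0_real := positive_definite_pair x 1 'i phiP.
  by rewrite rpredDl// rmorph1 mul1r conjCi mulr1 mulNr mulrBr.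
have eS := CrealP S; have eD := CrealP D.
rewrite rmorphD in eS; rewrite rmorphM rmorphB /= conjCi in eD.
have {}eD : (phi x)^* - (phi x^-1%g)^* = - (phi x - phi x^-1%g).
  by apply: (mulfI (neq0Ci C)); rewrite mulrN -eD mulNr opprK.
apply: (@mulfI _ 2) => //; rewrite [RHS]mulr_natl [LHS]mulr_natl !mulr2n.
have -> : phi x^-1%g + phi x^-1%g
        = phi x + phi x^-1%g - (phi x - phi x^-1%g) by ring.
by rewrite -eS -eD; ring.
Qed.

Lemma positive_definite_norm phi x :
  positive_definite phi -> `|phi x| <= phi 1%g.
Proof.
move=> phiP; have p1 := positive_definite1_ge0 phiP.
have [->|z0] := eqVneq (phi x) 0; first by rewrite normr0.
(* These weights turn the form into [2 z^2 (phi 1 - z)] with [z = |phi x|]. *)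
have := positive_definite_pair x `|phi x| (- (phi x)^*) phiP.
rewrite positive_definiteV// normrN norm_conjC normr_id rmorphN /= conjCK.
have n0 : 0 < `|phi x| by rewrite normr_gt0.
rewrite (conj_Creal (normr_real _)).
have -> : `|phi x| * - (phi x)^* * phi x + - phi x * `|phi x| * (phi x)^*
   = - 2 * `|phi x| * (phi x * (phi x)^*) by ring.
rewrite -normCK; set z := `|phi x| in n0 *.
have -> : (z ^+ 2 + z ^+ 2) * phi 1%g + -2 * z * z ^+ 2
   = 2 * z ^+ 2 * (phi 1%g - z) by ring.
by rewrite pmulr_rge0 ?subr_ge0// mulr_gt0// exprn_gt0.
Qed.

Lemma positive_definiteD phi psi : positive_definite phi ->
  positive_definite psi -> positive_definite (fun x => phi x + psi x).
Proof.
move=> phiP psiP n x c; have := addr_ge0 (phiP n x c) (psiP n x c).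
rewrite -big_split; congr (0 <= _); apply: eq_bigr => i _ /=.
by rewrite -big_split; apply: eq_bigr => j _ /=; rewrite mulrDr.
Qed.

(** After exchanging the sums, the form is a combination, with weights [d k], of the squared moduli
    of [\sum_i c i * e k i]. *)
Lemma gram_ge0 (I : finType) (K : Type) (r : seq K) (d : K -> C)
    (e : K -> I -> C) (c : I -> C) : (forall k, 0 <= d k) ->
  0 <= \sum_i \sum_j (c i)^* * c j * \sum_(k <- r) d k * ((e k i)^* * e k j).
Proof.
move=> d0; under eq_bigr do under eq_bigr do rewrite mulr_sumr.
under eq_bigr do rewrite exchange_big.
rewrite exchange_big sumr_ge0// => k _.
suff -> : \sum_i \sum_j (c i)^* * c j * (d k * ((e k i)^* * e k j))
        = d k * `|\sum_i c i * e k i| ^+ 2.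
  by rewrite mulr_ge0// exprn_ge0.
rewrite normCK [X in _ * X]mulrC rmorph_sum /= mulr_suml mulr_sumr.
apply: eq_bigr => i _; rewrite !mulr_sumr; apply: eq_bigr => j _.
by rewrite rmorphM /=; ring.
Qed.

Lemma positive_definite_cst (a : C) :
  0 <= a -> positive_definite (fun _ : G => a).
Proof.
move=> a0 n x c.
have := @gram_ge0 _ _ [:: tt] (fun=> a) (fun _ (_ : 'I_n) => 1) c (fun=> a0).
congr (0 <= _); apply: eq_bigr => i _; apply: eq_bigr => j _.
by rewrite big_seq1 rmorph1 !mulr1.
Qed.

Lemma positive_definite_delta :
  positive_definite (fun x : G => (x == 1%g)%:R : C).
Proof.
move=> n x c.
(* The kernel [x i = x j] is the Gram kernel of the indicators of the points; [undup] keeps a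
   repeated point from being counted twice. *)
pose e g i : C := (x i == g)%:R.
have := @gram_ge0 _ _ (undup (codom x)) (fun=> 1) e c (fun=> ler01).
congr (0 <= _); apply: eq_bigr => i _; apply: eq_bigr => j _; congr (_ * _).
rewrite (bigD1_seq (x i)) ?undup_uniq ?mem_undup ?codom_f//=.
rewrite big1 ?addr0 => [|k /negPf xk]; last first.
  by rewrite /e eq_sym xk rmorph0 mul0r mulr0.
rewrite /e eqxx rmorph1 !mul1r; congr (_%:R); apply: congr1.
apply/eqP/eqP => [->|]; first by rewrite mulVg.
by move=> /(congr1 (fun y => x i * y)%g); rewrite mulgA mulgV mul1g mulg1.
Qed.

(* Schur product theorem: diagonalising [phi] on the given points writes it as a
   nonnegative combination of rank one kernels. *)
Lemma positive_definiteM phi psi : positive_definite phi ->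
  positive_definite psi -> positive_definite (fun x => phi x * psi x).
Proof.
move=> phiP psiP n x c.
pose A : 'M[C]_n := \matrix_(i, j) phi ((x i)^-1 * x j)%g.
have /hermitian_normalmx/orthomx_spectralP eA : A \is hermsymmx.
  apply/is_hermitianmxP; apply/matrixP => i j; rewrite !mxE expr0 mul1r.
  by rewrite -positive_definiteV// invgM invgK.
have Pu := spectral_unitarymx A.
set P := spectralmx A in eA Pu; set d := spectral_diag A in eA.
have eA' := eA; rewrite invmx_unitary// in eA'.
have Aij i j : A i j = \sum_k d 0 k * ((P k i)^* * P k j).
  rewrite eA' !mxE; apply: eq_bigr => k _.
  by rewrite mul_mx_diag !mxE; ring.
(* An eigenvalue is the form of [phi] at the conjugate of row [k] of [P]. *)
have d0 k : 0 <= d 0 k.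
  have -> : d 0 k = (P *m A *m P^t*) k k.
    rewrite eA' !mulmxA (unitarymxP Pu) mul1mx -mulmxA (unitarymxP Pu) mulmx1.
    by rewrite mxE eqxx.
  have := phiP n x (fun i => (P k i)^*); congr (0 <= _).
  rewrite !mxE exchange_big; apply: eq_bigr => j _.
  rewrite !mxE mulr_suml; apply: eq_bigr => i _.
  by rewrite !mxE conjCK; ring.
have eS : \sum_(i < n) \sum_(j < n) (c i)^* * c j *
      (phi ((x i)^-1 * x j)%g * psi ((x i)^-1 * x j)%g) =
   \sum_k d 0 k * \sum_i \sum_j (c i * P k i)^* * (c j * P k j)
          * psi ((x i)^-1 * x j)%g.
  under [RHS]eq_bigr do rewrite mulr_sumr.
  rewrite [RHS]exchange_big; apply: eq_bigr => i _.
  under [RHS]eq_bigr do rewrite mulr_sumr.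
  rewrite [RHS]exchange_big; apply: eq_bigr => j _.
  have := Aij i j; rewrite mxE => ->.
  rewrite mulr_suml mulr_sumr; apply: eq_bigr => k _.
  by rewrite rmorphM /=; ring.
by rewrite eS sumr_ge0// => k _; rewrite mulr_ge0.
Qed.

(** The form of this function is that of [phi] at the points [x i * s k] with coefficients
    [c i * a k]. *)
Lemma positive_definite_polar phi (I : finType) (a : I -> C) (s : I -> G) :
  positive_definite phi ->
  positive_definite
    (fun x => \sum_i \sum_j (a i)^* * a j * phi ((s i)^-1 * x * s j)%g).
Proof.
move=> phiP n x c.
have := @positive_definite_fin ('I_n * I)%type phi
  (fun k => x k.1 * s k.2)%g (fun k => c k.1 * a k.2) phiP.
congr (0 <= _).
rewrite -(pair_bigA _ (fun i k => \sum_t (c i * a k)^* * (c t.1 * a t.2)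
  * phi ((x i * s k)^-1 * (x t.1 * s t.2))%g)) /=.
apply: eq_bigr => i _.
under eq_bigr => k _ do rewrite -(pair_bigA _ (fun j l =>
  (c i * a k)^* * (c j * a l) * phi ((x i * s k)^-1 * (x j * s l))%g)) /=.
rewrite exchange_big; apply: eq_bigr => j _.
rewrite mulr_sumr; apply: eq_bigr => k _; rewrite mulr_sumr.
apply: eq_bigr => l _; rewrite rmorphM invgM !mulgA /=.
ring.
Qed.

End PositiveDefinite.

(** * Limits of complex numbers along filters *)

Section ComplexLimits.
Variable R : realType.
Local Notation C := R[i].

Lemma normc_le_Re_Im (z : C) :
  `|z| <= (`|complex.Re z| + `|complex.Im z|)%:C%C.
Proof.
rewrite {1}(complexE z) (le_trans (ler_normD _ _))// normrM rmorphD/=.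
rewrite complexiE normCi mul1r.
have e (x : R) : `|x%:C%C| = `|x|%:C%C.
  by rewrite normc_def/= expr0n addr0 sqrtr_sqr.
by rewrite !e.
Qed.

Lemma normc_ge_Im (z : C) : `|complex.Im z|%:C%C <= `|z|.
Proof.
have := normc_ge_Re ('i * z); rewrite normrM normCi mul1r.
by rewrite -complexiE; case: z => a b /=; rewrite mul0r mul1r sub0r normrN.
Qed.

Lemma gt0_real_complex (e : C) : 0 < e -> exists2 d : R, 0 < d & e = d%:C%C.
Proof.
by case: e => a b; rewrite ltcE /= => /andP[/eqP -> a0]; exists a.
Qed.

(** Real and imaginary parts stay in a compact segment, and an ultrafilter converges to each of its
    cluster points. *)
Lemma bounded_ultra_cvg (T : Type) (U : set_system T) (z : T -> C) (M : C) :
  UltraFilter U -> (forall t, `|z t| <= M) ->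
  exists l : C^o, z t @[t --> U] --> l.
Proof.
move=> Uu zM.
have real_case (w : T -> R) (K : R) : (forall t, `|w t| <= K) ->
    exists l : R, forall e : R, 0 < e -> U [set t | `|l - w t| < e].
  move=> wK.
  have /(_ (w @ U)) := @segment_compact R (- K) K.
  case=> [|a [_ cla]].
    apply: (@filterS _ U _ setT) filterT => t _ /=.
    by rewrite in_itv /= -ler_norml.
  exists a => e e0; set V := ball a e.
  have [//|VC] := in_ultra_setVsetC (w @^-1` V) Uu.
  by have [y []] := cla (~` V) V VC (nbhsx_ballx a e e0).
have [|a wa] := real_case (fun t => complex.Re (z t)) (complex.Re M).
  move=> t.
  by have := le_trans (normc_ge_Re (z t)) (zM t); rewrite lecE => /andP[].
have [|b wb] := real_case (fun t => complex.Im (z t)) (complex.Re M).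
  move=> t.
  by have := le_trans (normc_ge_Im (z t)) (zM t); rewrite lecE => /andP[].
exists (Complex a b).
apply/(@cvgrPdist_lt C C^o) => e /gt0_real_complex[d d0 ->].
have d20 : 0 < d / 2 by rewrite divr_gt0.
apply: filterS2 (wa _ d20) (wb _ d20) => t at_ bt.
rewrite (le_lt_trans (normc_le_Re_Im _))// ltcR [d]splitr.
by move: at_ bt => /=; case: (z t) => x y /= ? ?; exact: ltrD.
Qed.

(** In [R[i]], [0 <= z] also says that [z] is real, so the imaginary part is followed to the limit
    as well as the real part. *)
Lemma cvg_complex_ge0 (T : Type) (F : set_system T) (z : T -> C) (l : C^o) :
  ProperFilter F -> (forall t, 0 <= z t) -> z t @[t --> F] --> l ->
  0 <= (l : C).
Proof.
move=> FF z0 /(@cvgrPdist_lt C C^o) zl.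
have zle (e : R) : 0 < e -> exists t, `|l - z t| < e%:C%C.
  by move=> e0; have := zl e%:C%C; rewrite ltcR => /(_ e0)/filter_ex.
rewrite lecE/=; apply/andP; split.
  rewrite -normr_eq0 eq_le normr_ge0 andbT.
  apply/ler_addgt0Pl => e /zle[t lt]; rewrite addr0.
  have := le_lt_trans (normc_ge_Im _) lt; rewrite ltcR => /ltW.
  move: (z0 t); rewrite lecE => /andP[/eqP/=].
  by case: l {zl zle lt} (z t) => ? ? [? ?]/= ->; rewrite subr0.
apply/ler_addgt0Pr => e /zle[t lt].
have := le_lt_trans (normc_ge_Re _) lt; rewrite ltcR => /ltW.
move: (z0 t); rewrite lecE => /andP[_]/=.
case: l {zl zle lt} (z t) => a ? [b ?]/= b0; rewrite ler_norml => /andP[+ _].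
lra.
Qed.

End ComplexLimits.

(** * The balls [D_r] *)

Section Ball.
Variables (R : realType) (G : groupType).
Local Notation C := R[i].
Implicit Types (f g h : G -> C) (r s : C).

(** This is [D_r]. With the number of summands fixed, and each bounded by its value at [1],
    pointwise limits can be taken summand by summand. *)
Definition fsball r f := exists phi : 'I_4 -> G -> C,
  [/\ forall k, positive_definite (phi k), \sum_k phi k 1%g <= r
    & forall x, f x = \sum_(k < 4) 'i ^+ k * phi k x].

Lemma expi4 : 'i ^+ 4 = 1 :> C.
Proof. by rewrite (exprM _ 2 2) sqrCi sqrrN expr1n. Qed.

Lemma norm_expi k : `|'i ^+ k| = 1 :> C.
Proof. by rewrite normrX normCi expr1n. Qed.

Lemma fsball_ge0 r f : fsball r f -> 0 <= r.
Proof.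
move=> [phi [phiP phir _]]; apply: le_trans phir.
by apply: sumr_ge0 => k _; exact: positive_definite1_ge0.
Qed.

Lemma fsball_le r s f : r <= s -> fsball r f -> fsball s f.
Proof.
by move=> rs [phi [? ? ?]]; exists phi; split=> //; exact: le_trans rs.
Qed.

Lemma eq_fsball r f g : f =1 g -> fsball r f -> fsball r g.
Proof. by move=> /funext ->. Qed.

Lemma fsball_norm r f x : fsball r f -> `|f x| <= r.
Proof.
move=> [phi [phiP phir ->]]; apply: le_trans (ler_norm_sum _ _ _) _.
apply: le_trans phir; apply: ler_sum => k _.
by rewrite normrM norm_expi mul1r positive_definite_norm.
Qed.

Lemma fsball0 r : 0 <= r -> fsball r (fun=> 0).
Proof.
move=> r0; exists (fun _ _ => 0); split=> [k||x].
  exact: positive_definite_cst.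
  by rewrite big1.
by rewrite big1// => k _; rewrite mulr0.
Qed.

Lemma fsball_expi (k : nat) phi :
  positive_definite phi -> fsball (phi 1%g) (fun x => 'i ^+ k * phi x).
Proof.
move=> phiP; pose k4 := inZp k : 'I_4.
exists (fun j x => if j == k4 then phi x else 0); split.
- by move=> j; case: eqP => // _; exact: positive_definite_cst.
- by rewrite -big_mkcond big_pred1_eq.
- move=> x; rewrite (bigD1 k4)//= eqxx big1 ?addr0 => [|j /negPf ->].
    by rewrite (expr_mod _ expi4).
  by rewrite mulr0.
Qed.

Lemma fsballD r s f g : fsball r f -> fsball s g -> fsball (r + s) (f + g).
Proof.
move=> [phi [phiP phir ef]] [psi [psiP psis eg]].
exists (fun k x => phi k x + psi k x); split.
- by move=> k; exact: positive_definiteD.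
- by rewrite big_split lerD.
- move=> x; transitivity (f x + g x) => //.
  by rewrite ef eg -big_split; apply: eq_bigr => k _; rewrite mulrDr.
Qed.

Lemma fsball_sum (I : Type) (t : seq I) (r : I -> C) (f : I -> G -> C) :
  (forall i, fsball (r i) (f i)) ->
  fsball (\sum_(i <- t) r i) (fun x => \sum_(i <- t) f i x).
Proof.
move=> rf; elim: t => [|i t IH].
  rewrite big_nil; apply: (eq_fsball _ (fsball0 (lexx 0))) => x.
  by rewrite big_nil.
rewrite big_cons; apply: (eq_fsball _ (fsballD (rf i) IH)) => x.
by rewrite big_cons.
Qed.

(** The sixteen products [phi k * psi l] are positive definite by Schur's theorem, and their
    coefficients i^(k+l) are again powers of i. *)
Lemma fsballM r s f g : fsball r f -> fsball s g -> fsball (r * s) (f * g).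
Proof.
move=> [phi [phiP phir ef]] [psi [psiP psis eg]].
have e k l : fsball (phi k 1%g * psi l 1%g)
    (fun x => 'i ^+ (k + l) * (phi k x * psi l x)).
  exact: (fsball_expi (k + l) (positive_definiteM (phiP k) (psiP l))).
have {}e := fsball_sum (index_enum 'I_4) (fun k =>
  fsball_sum (index_enum 'I_4) (e k)).
apply: fsball_le (eq_fsball _ e) => [|x].
  under eq_bigr do rewrite -mulr_sumr.
  rewrite -mulr_suml ler_pM// sumr_ge0// => k _; exact: positive_definite1_ge0.
transitivity (f x * g x) => //; rewrite ef eg mulr_suml.
apply: eq_bigr => k _; rewrite mulr_sumr; apply: eq_bigr => l _.
by rewrite exprD; ring.
Qed.

Lemma fsball_expi_cst (k : nat) (a : C) :
  0 <= a -> fsball a (fun=> 'i ^+ k * a).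
Proof.
by move=> a0; apply: (@fsball_expi k (fun=> a)); exact: positive_definite_cst.
Qed.

Lemma fsball_cst (a : C) : fsball (2 * `|a|) (fun=> a).
Proof.
(* The sign of a negative real is absorbed by two more powers of i. The factor 2 comes from
   [|Re a| + |Im a| <= 2 |a|]. *)
have rb (b : C) (k : nat) : b \is Num.real ->
    fsball `|b| (fun=> 'i ^+ k * b).
  move=> bR; have [b0|b0] := real_ge0P bR.
    exact: fsball_expi_cst.
  apply: (eq_fsball _ (fsball_expi_cst (k + 2) _)).
    by move=> x /=; rewrite exprD sqrCi mulrN1 mulrNN.
  by rewrite oppr_ge0 ltW.
have := fsballD (rb _ 0%N (Creal_Re a)) (rb _ 1%N (Creal_Im a)).
move=> /(fsball_le _)h; apply: (eq_fsball _ (h _ _)) => [x|].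
  by rewrite [RHS]Crect expr0 mul1r expr1.
rewrite mulrDl !mul1r lerD//.
  by rewrite leif_normC_Re_Creal.
have := (leif_normC_Re_Creal ('i * a)).1.
by rewrite ReMil normrN normrM normCi mul1r.
Qed.

Lemma fsballZ (a : C) r f : fsball r f ->
  fsball (2 * `|a| * r) (fun x => a * f x).
Proof. exact: fsballM (fsball_cst a). Qed.

Lemma fsballX r f n : fsball r f -> fsball (r ^+ n) (f ^+ n).
Proof.
move=> rf; elim: n => [|n IH]; last by rewrite !exprS; exact: fsballM.
rewrite expr0; have := fsball_expi_cst 0 ler01.
by apply: eq_fsball => x; rewrite expr0 mul1r.
Qed.

Lemma fourier_stieltjesP f :
  fourier_stieltjes R G f <-> exists r, fsball r f.
Proof.
split=> [[n [c [phi [phiP ->]]]]|[r [phi [phiP _ ef]]]].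
  exists (\sum_(i < n) 2 * `|c i| * phi i 1%g); apply: fsball_sum => i.
  by apply: fsballZ; apply: eq_fsball (fsball_expi 0 (phiP i)) => x;
     rewrite expr0 mul1r.
by exists 4%N, (fun k : 'I_4 => 'i ^+ k), phi; split=> //; apply/funext.
Qed.

(** Polarization: for [|a| = 1], [h a] is twice the mass at [1], plus [a^*] times the mass at [y],
    plus [a] times the mass at [y^-1]. Hence [(h 1 + i h i) / 2] is the mass at [y] plus [1 + i]
    times the mass at [1]. *)
Lemma fsball_delta (y : G) : exists r, fsball r (fun x => (x == y)%:R).
Proof.
pose d (x : G) : C := (x == 1%g)%:R.
pose h (a : C) x := \sum_(i : bool) \sum_(j : bool)
  (if i then a else 1)^* * (if j then a else 1)
  * d ((if i then y else 1%g)^-1 * x * (if j then y else 1%g))%g.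
have hP a : positive_definite (h a).
  apply: (@positive_definite_polar _ _ d _ (fun i : bool => if i then a else 1)
    (fun i : bool => if i then y else 1%g)).
  exact: positive_definite_delta.
have bd := fsball_expi 0 (@positive_definite_delta R G).
have b1 := fsball_expi 0 (hP 1).
have bi := fsball_expi 1 (hP 'i).
have bN := fsballZ (- (1 + 'i)) (fsballD bd bd).
have := fsballZ (2^-1) (fsballD (fsballD b1 bi) bN).
move=> b; eexists; apply: eq_fsball b => x.
have dC (u v : G) : (u^-1 * v == 1)%g = (v == u).
  apply/eqP/eqP => [|->]; last by rewrite mulVg.
  by move=> /(congr1 (fun w => u * w)%g); rewrite mulgA mulgV mul1g mulg1.
have dy : d (y^-1 * x * y)%g = d x.
  rewrite /d; congr (_%:R); apply: congr1; rewrite -mulgA dC.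
  apply/eqP/eqP => [|->]; last by rewrite mul1g.
  by move=> /(congr1 (fun w => w * y^-1)%g); rewrite -mulgA mulgV mulg1.
rewrite !fctE /h !big_bool /= !expr0 !expr1 !mul1r invg1 !mul1g !mulg1.
rewrite rmorph1 dy conjCi -/(d x) -dC -/(d (y^-1 * x)%g).
set p := d (y^-1 * x)%g; set q := d (x * y)%g.
have -> : 2^-1 * (1 * 1 * d x + 1 * 1 * p + (1 * 1 * q + 1 * 1 * d x) +
   'i * (- 'i * 'i * d x + - 'i * 1 * p + (1 * 'i * q + 1 * 1 * d x)) +
   - (1 + 'i) * (d x + d x)) = p => //.
transitivity (p + 2^-1 * ('i ^+ 2 + 1) * (q - p - 'i * d x)); first by field.
by rewrite sqrCi addNr mulr0 mul0r addr0.
Qed.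

(** Approximants are indexed by a finite set and a precision. Along an ultrafilter their four
    components converge, and positive definiteness and the bound at [1] survive in the limit. *)
Lemma closed_fsball r f :
  (forall (s : seq G) (e : C), 0 < e ->
     exists2 g, fsball r g & forall x, x \in s -> `|f x - g x| < e) ->
  fsball r f.
Proof.
move=> fr.
have /choice[g gP] : forall t : seq G * nat, exists g, fsball r g /\
    forall x, x \in t.1 -> `|f x - g x| < t.2.+1%:R^-1.
  move=> [s n]; have [|g rg gf] := fr s n.+1%:R^-1; last by exists g.
  by rewrite invr_gt0 ltr0n.
have /choice[phi phiP] := fun t => (gP t).1.
pose above (t : seq G * nat) :=
  [set u : seq G * nat | {subset t.1 <= u.1} /\ (t.2 <= u.2)%N].
pose F := filter_from [set: seq G * nat] above.
have FF : ProperFilter F.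
  apply: filter_from_proper => [|t _]; last by exists t; split.
  apply: filter_fromT_filter; first by exists ([::], 0%N).
  move=> t u; exists (t.1 ++ u.1, maxn t.2 u.2) => v [/= sv].
  rewrite geq_max => /andP[tv uv]; split; split=> // x xs; apply: sv.
    by rewrite mem_cat xs.
  by rewrite mem_cat xs orbT.
have [U [Uu FU]] := ultraFilterLemma FF.
have phi_norm k x t : `|phi t k x| <= r.
  have [pd + _] := phiP t; apply: le_trans.
  rewrite (bigD1 k)//= (le_trans (positive_definite_norm x (pd k)))//.
  by rewrite lerDl sumr_ge0// => l _; exact: positive_definite1_ge0.
have /choice[psi psiP] : forall k, exists psi : G -> C^o, forall x,
    phi t k x @[t --> U] --> psi x.
  move=> k; have ex x := bounded_ultra_cvg Uu (phi_norm k x).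
  by have [psi psiP] := choice ex; exists psi.
have cvg_psi (c : C) k x :
    (c * phi t k x : C^o) @[t --> U] --> (c * psi k x : C^o).
  exact: (@cvgZl_tmp C C^o _ U _ c _ _ (psiP k x)).
have cvg_sum (I : Type) (t : seq I) (u : I -> seq G * nat -> C^o)
    (l : I -> C^o) :
    (forall i, u i v @[v --> U] --> l i) ->
    (\sum_(i <- t) u i v) @[v --> U] --> \sum_(i <- t) l i.
  move=> ul; apply: cvg_big => //; exact: add_continuous.
exists psi; split.
- move=> k n x c.
  apply: (@cvg_complex_ge0 R _ U (fun t =>
    \sum_i \sum_j (c i)^* * c j * phi t k ((x i)^-1 * x j)%g)).
    by move=> t; have [pd _ _] := phiP t; exact: pd.
  by apply: (cvg_sum) => i; apply: (cvg_sum) => j; exact: cvg_psi.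
- rewrite -subr_ge0; apply: (@cvg_complex_ge0 R _ U (fun t =>
    r - \sum_k phi t k 1%g)).
    by move=> t; rewrite subr_ge0; have [] := phiP t.
  apply: (@cvgB C C^o _ U _ (fun=> r)); first exact: cvg_cst.
  by apply: (cvg_sum) => k; exact: psiP.
(* The values [g t x] tend to [f x] by the choice of [g], and to the combination of the [psi k x] by
   linearity. *)
- move=> x; apply: (@cvg_unique C^o _ ((fun t => g t x : C^o) @ U)).
  + exact: norm_hausdorff.
  + apply/(@cvgrPdist_lt C C^o) => e /gt0_real_complex[d d0 ->].
    have [n dn] : exists n : nat, n.+1%:R^-1 < d.
      have [n _ nd] := near_infty_natSinv_lt (PosNum d0).
      by exists n; exact: nd (leqnn n).
    apply: (@filterS _ U _ (above ([:: x], n))); last first.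
      by apply: FU; exists ([:: x], n).
    move=> t [/= xt nt]; have [_ gt] := gP t.
    rewrite (lt_trans (gt x _)) ?xt ?mem_head//.
    rewrite (_ : t.2.+1%:R^-1 = (t.2.+1%:R^-1)%:C%C); last first.
      by rewrite fmorphV rmorph_nat.
    rewrite ltcR (le_lt_trans _ dn)// lef_pV2 ?posrE ?ltr0n// ler_nat ltnS//.
  + have -> : (fun t => g t x) = fun t => \sum_(k < 4) 'i ^+ k * phi t k x.
      by apply/funext => t; have [] := phiP t.
    by apply: (cvg_sum) => k; exact: cvg_psi.
Qed.

End Ball.

(** * Neumann series, and the quotient by finitely supported functions *)

Section Algebra.
Variables (R : realType) (G : groupType).
Local Notation C := R[i].
Implicit Types (f g h u v : G -> C) (r s c e : C) (x y : G).
Local Notation fs := (fourier_stieltjes R G).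

Lemma fsball_fs r f : fsball r f -> fs f.
Proof. by move=> rf; apply/fourier_stieltjesP; exists r. Qed.

Lemma fsD f g : fs f -> fs g -> fs (f + g).
Proof.
move=> /fourier_stieltjesP[r rf] /fourier_stieltjesP[s sg].
exact: fsball_fs (fsballD rf sg).
Qed.

Lemma fsM f g : fs f -> fs g -> fs (f * g).
Proof.
move=> /fourier_stieltjesP[r rf] /fourier_stieltjesP[s sg].
exact: fsball_fs (fsballM rf sg).
Qed.

Lemma fsX f n : fs f -> fs (f ^+ n).
Proof.
by move=> /fourier_stieltjesP[r rf]; exact: fsball_fs (fsballX n rf).
Qed.

Lemma fs_cst c : fs (fun=> c). Proof. exact: fsball_fs (fsball_cst G c). Qed.

Lemma fs_delta y : fs (fun x => (x == y)%:R).
Proof. by have [r rd] := fsball_delta R y; exact: fsball_fs rd. Qed.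

Lemma fs_sum (I : Type) (t : seq I) (f : I -> G -> C) :
  (forall i, fs (f i)) -> fs (\sum_(i <- t) f i).
Proof.
move=> ff; elim: t => [|i t IH]; first by rewrite big_nil; exact: fs_cst.
by rewrite big_cons; exact: fsD.
Qed.

Lemma finite_supportE h : finite_set [set x | h x != 0] ->
  exists t : seq G, h = \sum_(y <- t) (fun=> h y) * (fun x => (x == y)%:R).
Proof.
move=> /finite_seqP[t ht]; exists (undup t); apply/funext => x.
rewrite fct_sumE/=.
have [xt|xt] := boolP (x \in t).
  rewrite (bigD1_seq x) ?mem_undup ?undup_uniq//= !fctE eqxx mulr1.
  rewrite big1 ?addr0// => y /negPf yx.
  by rewrite !fctE eq_sym yx mulr0.
rewrite big_seq big1 => [|y].
  apply/eqP; apply: contraNT xt => hx.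
  by have : [set` t] x by rewrite -ht.
rewrite mem_undup !fctE => yt.
by case: eqP => [xy|]; rewrite ?mulr0//; rewrite xy yt in xt.
Qed.

Lemma fs_finite_support h : finite_set [set x | h x != 0] -> fs h.
Proof.
move=> /finite_supportE[t ->]; apply: fs_sum => y.
by apply: fsM; [exact: fs_cst|exact: fs_delta].
Qed.

Lemma fs_finite_modification f g :
  finite_set [set x | f x != g x] -> fs g -> fs f.
Proof.
move=> fg gP; rewrite -(subrK g f); apply: fsD => //.
apply: fs_finite_support; apply: sub_finite_set fg => x /=.
by rewrite !fctE subr_eq0.
Qed.

Lemma expr_lt (q e : C) : 0 <= q -> q < 1 -> 0 < e ->
  exists N, forall n, (N <= n)%N -> q ^+ n < e.
Proof.
move=> q0 q1 /gt0_real_complex[d d0 ->].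
move: q0 q1; case: q => a b; rewrite lecE ltcE/= => /andP[/eqP ->] a0.
move=> /andP[_ a1].
have : `|a| < 1 by rewrite ger0_norm.
move=> /cvg_expr /cvgr0_norm_lt /(_ d d0) [N _ Nd].
exists N => n /Nd /=; rewrite ger0_norm ?exprn_ge0// => an.
by rewrite (_ : Complex a 0 = a%:C%C)// -rmorphXn ltcR.
Qed.

(** The partial sums of the geometric series lie in the ball of radius [(1 - r)^-1] and converge
    pointwise, so [closed_fsball] applies. *)
Lemma neumann r u : r < 1 -> fsball r u ->
  fsball (1 - r)^-1 (fun x => (1 - u x)^-1).
Proof.
move=> r1 ru; have r0 := fsball_ge0 ru.
have r10 : 0 < 1 - r by rewrite subr_gt0.
apply: closed_fsball => t e e0.
have [N /(_ N (leqnn N)) Ne] : exists N, forall n, (N <= n)%N ->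
    r ^+ n < e * (1 - r).
  by apply: expr_lt => //; rewrite mulr_gt0.
exists (\sum_(k < N) u ^+ k) => [|x _].
  apply: fsball_le (eq_fsball _ (fsball_sum (index_enum 'I_N) (fun k : 'I_N =>
    fsballX k ru))) => [|x]; last by rewrite fct_sumE.
  rewrite -[_^-1]mul1r ler_pdivlMr// mulrC -opprB mulNr -subrX1 opprB.
  by rewrite lerBlDr lerDl exprn_ge0.
have ux : `|u x| <= r by exact: fsball_norm ru.
have n1 : 1 - r <= `|1 - u x|.
  by rewrite (le_trans _ (lerB_dist _ _))// normr1 lerD2l lerN2.
have u0 : 1 - u x != 0 by rewrite -normr_gt0 (lt_le_trans r10).
have -> : (1 - u x)^-1 - (\sum_(k < N) u ^+ k) x = u x ^+ N / (1 - u x).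
  rewrite fct_sumE; under eq_bigr do rewrite exprfctE.
  apply: (mulIf u0); rewrite mulrBl mulVf// mulfVK// mulrC.
  by rewrite -[X in _ - X]opprK -mulNr opprB -subrX1 opprK addrC subrK.
rewrite normrM normfV normrX ltr_pdivrMr ?normr_gt0//.
apply: le_lt_trans (_ : r ^+ N < _); first by rewrite lerXn2r ?nnegrE.
by rewrite (lt_le_trans Ne)// ler_pM2l.
Qed.

(* Elements of the [r]-ball of [B(G)/c_00(G)]. *)
Definition ess_ball r f :=
  exists2 u, fsball r u & finite_set [set x | f x != u x].

Lemma fsball_ess r f : fsball r f -> ess_ball r f.
Proof.
move=> rf; exists f => //; apply: (sub_finite_set _ (@finite_set0 G)).
by move=> x /=; rewrite eqxx.
Qed.

Lemma ess_ball_le r s f : r <= s -> ess_ball r f -> ess_ball s f.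
Proof. by move=> rs [u ru fu]; exists u => //; exact: fsball_le ru. Qed.

Lemma ess_ballD r s f g :
  ess_ball r f -> ess_ball s g -> ess_ball (r + s) (f + g).
Proof.
move=> [u ru fu] [v sv gv]; exists (u + v); first exact: fsballD.
apply: sub_finite_set
  (_ : _ `<=` [set x | f x != u x] `|` [set x | g x != v x]) _.
  move=> x /=; have [fx|] := eqVneq (f x) (u x); last by left.
  by have [gx|] := eqVneq (g x) (v x); [rewrite !fctE fx gx eqxx|right].
by rewrite finite_setU.
Qed.

Lemma ess_ballM r s f g :
  ess_ball r f -> ess_ball s g -> ess_ball (r * s) (f * g).
Proof.
move=> [u ru fu] [v sv gv]; exists (u * v); first exact: fsballM.
apply: sub_finite_set
  (_ : _ `<=` [set x | f x != u x] `|` [set x | g x != v x]) _.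
  move=> x /=; have [fx|] := eqVneq (f x) (u x); last by left.
  by have [gx|] := eqVneq (g x) (v x); [rewrite !fctE fx gx eqxx|right].
by rewrite finite_setU.
Qed.

Lemma ess_ball_sum (I : Type) (t : seq I) (r : I -> C) (f : I -> G -> C) :
  (forall i, ess_ball (r i) (f i)) ->
  ess_ball (\sum_(i <- t) r i) (\sum_(i <- t) f i).
Proof.
move=> rf; elim: t => [|i t IH].
  by rewrite !big_nil; exact/fsball_ess/fsball0.
by rewrite !big_cons; exact: ess_ballD.
Qed.

Lemma ess_ballMn r f n : ess_ball r f -> ess_ball (r *+ n) (f *+ n).
Proof.
move=> rf; elim: n => [|n IH]; first exact/fsball_ess/fsball0.
by rewrite !mulrS; exact: ess_ballD.
Qed.

(* The spectral radius of [f] in [B(G)/c_00(G)] is at most [r]. *)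
Definition growth c r f := forall n, ess_ball (c * r ^+ n) (f ^+ n).

Lemma growth_ge0 c r f : growth c r f -> 0 <= c.
Proof. by move=> /(_ 0%N) [u /fsball_ge0]; rewrite mulr1. Qed.

Lemma growth_le c r s f : 0 <= r -> r <= s -> growth c r f -> growth c s f.
Proof.
move=> r0 rs gf n; apply: ess_ball_le (gf n).
by rewrite ler_wpM2l ?(growth_ge0 gf)// lerXn2r ?nnegrE// (le_trans r0).
Qed.

Lemma fsball_growth r f : fsball r f -> growth 1 r f.
Proof. by move=> rf n; rewrite mul1r; exact/fsball_ess/fsballX. Qed.

(** The binomial theorem makes the two geometric bounds add up to the expansion of [(r + s) ^+ n],
    with the constants factored out. *)
Lemma growthD c d r s f g :
  growth c r f -> growth d s g -> growth (c * d) (r + s) (f + g).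
Proof.
move=> gf gg n; rewrite !exprDn mulr_sumr.
have -> : \sum_(i < n.+1) c * d * (r ^+ (n - i) * s ^+ i *+ 'C(n, i))
   = \sum_(i < n.+1) (c * r ^+ (n - i)) * (d * s ^+ i) *+ 'C(n, i).
  by apply: eq_bigr => i _; rewrite mulrnAr; congr (_ *+ _); ring.
by apply: ess_ball_sum => i; apply: ess_ballMn; exact: ess_ballM.
Qed.

Lemma growthM c d r s f g :
  growth c r f -> growth d s g -> growth (c * d) (r * s) (f * g).
Proof.
move=> gf gg n; rewrite !exprMn.
by rewrite mulrACA; exact: ess_ballM.
Qed.

Definition quasinilpotent f := forall e, 0 < e -> exists c, growth c e f.

Lemma quasinilpotent_finite_support h :
  finite_set [set x | h x != 0] -> quasinilpotent h.
Proof.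
(* The power 0 is the constant 1, whose ball has radius 1; every higher power vanishes off a finite
   set. *)
move=> hf e e0; exists 1 => -[|n].
  rewrite !expr0 mulr1; apply: fsball_ess.
  have /(_ G) b := @fsball_expi_cst R _ 0 1 ler01.
  by apply: eq_fsball b => x; rewrite mul1r.
exists (fun=> 0); first by apply: fsball0; rewrite mul1r exprn_ge0// ltW.
apply: sub_finite_set hf => x /=; apply: contra => /eqP hx.
by rewrite !fctE hx expr0n.
Qed.

Lemma quasinilpotentD f g :
  quasinilpotent f -> quasinilpotent g -> quasinilpotent (f + g).
Proof.
move=> qf qg e e0; have e20 : 0 < e / 2 by rewrite divr_gt0.
have [c cf] := qf _ e20; have [d dg] := qg _ e20.
by exists (c * d); have := growthD cf dg; rewrite -splitr.
Qed.

Lemma quasinilpotentM f g : fs f -> quasinilpotent g -> quasinilpotent (f * g).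
Proof.
move=> /fourier_stieltjesP[r rf] qg e e0.
(* Since [r] may be 0, the division is by [r + 1]. *)
have r10 : 0 < r + 1 by rewrite ltr_wpDl// (fsball_ge0 rf).
have [c cg] := qg (e / (r + 1)) (divr_gt0 e0 r10).
exists (1 * c).
have := growthM (fsball_growth rf) cg; apply: growth_le.
  by rewrite mulr_ge0 ?(fsball_ge0 rf)// divr_ge0// ltW.
rewrite mulrCA ler_piMr ?(ltW e0)// ler_pdivrMr// mul1r lerDl ler01//.
Qed.

Lemma quasinilpotent_closed f :
  (forall e, 0 < e -> exists2 g, quasinilpotent g & fsball e (f - g)) ->
  quasinilpotent f.
Proof.
move=> fg e e0; have e20 : 0 < e / 2 by rewrite divr_gt0.
have [g qg fge] := fg _ e20; have [c cg] := qg _ e20.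
exists (c * 1); have := growthD cg (fsball_growth fge).
by rewrite -splitr addrC subrK.
Qed.

End Algebra.

(** * Spectra and resolvents of functions vanishing at infinity *)

Section NaturalSpectrum.
Variables (R : realType) (G : groupType).
Local Notation C := R[i].
Implicit Types (f g h u v : G -> C) (r s c e : C) (x y : G).
Local Notation fs := (fourier_stieltjes R G).

(** Some power of [f / c] enters, off a finite set, a ball of radius less than 1, where the Neumann
    series is available. *)
Lemma quasinilpotent_power f c : quasinilpotent f -> c != 0 ->
  exists n r v, [/\ (0 < n)%N, r < 1, fsball r v
    & finite_set [set x | f x ^+ n != c ^+ n * v x]].
Proof.
move=> qf cN0; have c0 : 0 < `|c| by rewrite normr_gt0.
have [d df] := qf (`|c| / 4) (divr_gt0 c0 (ltr0Sn _ _)).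
have d0 := growth_ge0 df.
(* Scaling by [fsballZ] costs a factor 2, so [2 * d * 4^-n < 1] is wanted; the [+ 1] covers
   [d = 0]. *)
have [N /(_ N.+1 (leqnSn _)) Nd] : exists N, forall n, (N <= n)%N ->
    4^-1 ^+ n < (2 * d + 1)^-1 :> C.
  apply: expr_lt; first by rewrite invr_ge0.
    by rewrite invf_lt1// ltr1n.
  by rewrite invr_gt0 ltr_wpDl// mulr_ge0.
have [u ud fu] := df N.+1.
exists N.+1, (2 * `|(c ^- N.+1)| * (d * (`|c| / 4) ^+ N.+1)).
exists (fun x => c ^- N.+1 * u x); split=> //.
- rewrite normfV normrX.
  have -> : 2 * `|c| ^- N.+1 * (d * (`|c| / 4) ^+ N.+1)
          = 2 * d * 4^-1 ^+ N.+1.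
    by rewrite exprMn; field; rewrite expf_neq0// lt0r_neq0.
  rewrite (@le_lt_trans _ _ ((2 * d) * (2 * d + 1)^-1))//.
    by rewrite ler_wpM2l ?mulr_ge0// ltW.
  by rewrite ltr_pdivrMr ?mul1r ?ltrDl// ltr_wpDl// mulr_ge0.
- exact: fsballZ.
- apply: sub_finite_set fu => x /=.
  by rewrite exprfctE mulVKf// expf_neq0.
Qed.

(** Where [|f| >= e], the equality [f^n = e^n v] would give [|v| >= 1]; such points therefore lie in
    the finite exceptional set. *)
Lemma quasinilpotent_c0 f : quasinilpotent f -> c0 R G f.
Proof.
move=> qf e e0.
have [n [r [v [n0 r1 rv fv]]]] := quasinilpotent_power qf (lt0r_neq0 e0).
apply: sub_finite_set fv => x /= ex; apply/eqP => fx.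
have := congr1 Num.norm fx; rewrite normrM !normrX (ger0_norm (ltW e0)) => nf.
have : e ^+ n <= e ^+ n * `|v x|.
  by rewrite -nf lerXn2r ?nnegrE// ltW.
rewrite ler_pMr ?exprn_gt0// => v1.
by have := le_lt_trans (le_trans v1 (fsball_norm x rv)) r1; rewrite ltxx.
Qed.

Lemma complex_le_nat c : 0 <= c -> exists N : nat, c <= N%:R.
Proof.
case: c => a b; rewrite lecE/= => /andP[/eqP -> a0]; exists (Num.bound a).
have -> : (Num.bound a)%:R = ((Num.bound a)%:R : R)%:C%C by rewrite rmorph_nat.
by rewrite lecE/= eqxx/= ltW// archi_boundP.
Qed.

Lemma closureP (A : set C) (l : C) : closure (A : set C^o) l <->
  forall e, 0 < e -> exists2 z, A z & `|l - z| < e.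
Proof.
split=> [cA e e0|lA B /nbhs_ballP[e /= e0 eB]].
  by have [z []] := cA _ (nbhsx_ballx (l : C^o) e e0); exists z.
by have [z Az lz] := lA e e0; exists z; split=> //; exact: eB.
Qed.

(** An inverse of [f - l] in B(G) is bounded, which keeps the values of [f] away from [l]. *)
Lemma spectrum_closure f : closure (range f : set C^o) `<=` spectrum f.
Proof.
move=> l /closureP fl [g /fourier_stieltjesP[r rg] fg1].
have r10 : 0 < r + 1 by rewrite ltr_wpDl// (fsball_ge0 rg).
have [|_ [x _ <-] lx] := fl (r + 1)^-1; first by rewrite invr_gt0.
have := congr1 (fun h => `|h x|) fg1; rewrite !fctE normrM normr1 => e1.
have : `|f x - l| * `|g x| <= (r + 1)^-1 * r.
  by rewrite ler_pM// ?(fsball_norm x rg)// distrC ltW.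
rewrite e1 mulrC ler_pdivlMr// mul1r gerDl => /(lt_le_trans (@ltr01 C)).
by rewrite ltxx.
Qed.

Lemma resolvent f l : c0 R G f -> quasinilpotent f -> fs f ->
  ~ closure (range f : set C^o) l -> fs (fun x => (f x - l)^-1).
Proof.
move=> f0 qf ff nl.
have [d d0 dl] : exists2 d, 0 < d & forall x, d <= `|f x - l|.
  apply: contrapT => nd; apply: nl; apply/closureP => e e0.
  apply: contrapT => ne; apply: nd; exists e => // x.
  rewrite real_leNgt ?normr_real ?gtr0_real//; apply/negP => xe; apply: ne.
  by exists (f x); [exists x|rewrite distrC].
have fl x : f x - l != 0 by rewrite -normr_gt0 (lt_le_trans d0).
(* For [l = 0], [f] is bounded away from 0 and vanishes at infinity, so [G] is finite. *)
have [l0|l0] := eqVneq l 0.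
  apply: fs_finite_support; apply: sub_finite_set (f0 d d0) => x _ /=.
  by have := dl x; rewrite l0 subr0.
have [n [r [v [n0 r1 rv fv]]]] := quasinilpotent_power qf l0.
have wP := fsball_fs (neumann r1 rv).
(* Off a finite set [f^n - l^n = - l^n (1 - v)]; dividing the factorization of [f^n - l^n] by it
   expresses the inverse of [f - l]. *)
apply: (@fs_finite_modification _ _ _ ((fun=> - l ^- n) *
  ((\sum_(i < n) f ^+ (n.-1 - i) * (fun=> l) ^+ i) *
   (fun x => (1 - v x)^-1)))); last first.
  apply: fsM; first exact: fs_cst.
  apply: fsM => //; apply: fs_sum => i.
  by apply: fsM; apply: fsX => //; exact: fs_cst.
apply: sub_finite_set fv => x /=; apply: contra => /eqP fv.
have v1 : 1 - v x != 0.
  rewrite subr_eq0; apply/eqP => v1; have := fsball_norm x rv.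
  by rewrite -v1 normr1 => /le_lt_trans/(_ r1); rewrite ltxx.
rewrite !fctE fct_sumE; apply/eqP/(mulfI (fl x)); rewrite divff//.
rewrite mulrCA [X in _ * X]mulrA.
under eq_bigr do rewrite !fctE.
rewrite -subrXX fv; have := expf_neq0 n l0; set L := l ^+ n => L0.
by field; rewrite v1.
Qed.

Lemma quasinilpotent_natural_spectrum f :
  fs f -> quasinilpotent f -> natural_spectrum R G f.
Proof.
move=> ff qf; split=> //; apply/seteqP; split=> [l lf|].
  apply: contrapT => nl; apply: lf.
  have := resolvent (quasinilpotent_c0 qf) qf ff nl.
  exists (fun x => (f x - l)^-1) => //.
  apply/funext => x; rewrite !fctE divff//.
  apply/eqP => fl; apply: nl; apply/closureP => e e0; exists (f x) => //.
  by rewrite distrC fl normr0.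
exact: spectrum_closure.
Qed.

(** The values of modulus at least [|l| / 2] form a finite, hence closed, set; all others are at
    distance more than [|l| / 2] from [l]. *)
Lemma closure_range_c0 f l : c0 R G f -> l != 0 ->
  closure (range f : set C^o) l -> range f l.
Proof.
move=> f0 l0 cl; have d0 : 0 < `|l| / 2 by rewrite divr_gt0// normr_gt0.
pose A := [set f x | x in [set x | `|l| / 2 <= `|f x|]].
have cA : closed (A : set C^o).
  have [+ _] := @accessible_finite_set_closed C^o; apply.
    exact/hausdorff_accessible/norm_hausdorff.
  exact/finite_image/f0.
apply: contrapT => nl.
have nA : ~ A l by move=> [x _ fx]; apply: nl; exists x.
have := cl _ (filterI (open_nbhs_nbhs (conj (closed_openC cA) nA))
  (nbhsx_ballx (l : C^o) _ d0)).
move=> [z [[x _ <-] [/= nAx lx]]]; apply: nAx; exists x => //=.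
have := le_lt_trans (lerB_dist l (f x)) lx.
rewrite ltrBlDr => /ltW; rewrite [X in X <= _]splitr.
by rewrite lerD2l.
Qed.

Lemma circle_avoiding_range f e : c0 R G f -> 0 < e ->
  exists r, [/\ 0 < r, r <= e & forall x, `|f x| != r].
Proof.
move=> f0 e0; have e20 : 0 < e / 2 by rewrite divr_gt0.
(* Infinitely many distinct radii in [(e / 2, e]]: if all were moduli of values, [|f| >= e / 2]
   would hold at infinitely many points. *)
pose r (k : nat) := e / 2 + e / 2 / k.+1%:R.
have e2r k : e / 2 < r k by rewrite ltrDl divr_gt0.
apply: contrapT => nr.
have /choice[p pP] : forall k, exists x, `|f x| = r k.
  move=> k; apply: contrapT => nx; apply: nr; exists (r k); split.
  - exact: lt_trans (e2r k).
  - by rewrite [leRHS]splitr lerD2l ler_pdivrMr// ler_pMr// ler1n.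
  - by move=> x; apply/eqP => fx; apply: nx; exists x.
have : finite_set (p @^-1` [set x | e / 2 <= `|f x|]).
  apply: finite_preimage (f0 _ e20) => k l _ _ /(congr1 (fun x => `|f x|)).
  rewrite !pP => /addrI/(mulfI (lt0r_neq0 e20))/invr_inj/eqP.
  by rewrite eqr_nat eqSS => /eqP.
have -> : p @^-1` [set x | e / 2 <= `|f x|] = setT.
  by apply/seteqP; split=> // k _ /=; rewrite pP ltW.
exact: infinite_nat.
Qed.

(** Write [m - f = (l - f) (1 - (l - m) / (l - f))]. The choice of [d] puts the quotient in the ball
    of radius 1/2, and its Neumann series costs a factor 2. *)
Lemma resolvent_bounded_near f l r : (forall x, f x != l) ->
  fsball r (fun x => (l - f x)^-1) ->
  exists2 d, 0 < d & forall m, `|l - m| < d ->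
    fsball (r * 2) (fun x => (m - f x)^-1).
Proof.
move=> fl rl; have r0 := fsball_ge0 rl.
have r10 : 0 < 4 * (r + 1) by rewrite mulr_gt0// ltr_wpDl.
exists (4 * (r + 1))^-1; first by rewrite invr_gt0.
move=> m lm.
have v2 : fsball (2^-1) (fun x => (l - m) * (l - f x)^-1).
  apply: fsball_le (fsballZ (l - m) rl).
  rewrite (@le_trans _ _ (2 * (4 * (r + 1))^-1 * r))//.
    by rewrite ler_wpM2r// ler_wpM2l// ltW.
  have -> : 2 * (4 * (r + 1))^-1 * r = r / (2 * (r + 1)).
    by field; rewrite lt0r_neq0// ltr_wpDl.
  rewrite ler_pdivrMr ?mulr_gt0 ?ltr_wpDl// mulKf ?pnatr_eq0//.
  by rewrite lerDl.
have h2 : (2^-1 : C) < 1 by rewrite invf_lt1// ltr1n.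
have := fsballM rl (neumann h2 v2).
rewrite (_ : (1 - 2^-1)^-1 = 2 :> C); last by field.
apply: eq_fsball => x; rewrite fctE -invfM; congr (_^-1).
by field; rewrite subr_eq0 eq_sym.
Qed.

(* Compactness of the circle, through an ultrafilter on the indices of a
   sequence of resolvents of unbounded norm. *)
Lemma resolvent_bounded_circle f r :
  (forall l, `|l| = r -> (forall x, f x != l) /\ fs (fun x => (l - f x)^-1)) ->
  exists c, forall l, `|l| = r -> fsball c (fun x => (l - f x)^-1).
Proof.
move=> fr; apply: contrapT => nc.
have /choice[l lP] : forall n : nat, exists l, `|l| = r /\
    ~ fsball n%:R (fun x => (l - f x)^-1).
  move=> n; apply: contrapT => nl; apply: nc; exists n%:R => l lr.
  by apply: contrapT => h; apply: nl; exists l.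
have [U [Uu FU]] := ultraFilterLemma (eventually_filter).
have ln n : `|l n| <= r by have [->] := lP n.
have [m /(@cvgrPdist_lt C C^o) lm] := bounded_ultra_cvg Uu ln.
have mr : `|m : C| = r.
  have [//|] := eqVneq (`|m : C|) r; rewrite -subr_eq0 -normr_gt0 => /lm.
  move=> /filter_ex[n /= mn]; have [ln_r _] := lP n.
  by have := le_lt_trans (ler_dist_dist _ _) mn; rewrite ln_r ltxx.
have [fm /fourier_stieltjesP[s sm]] := fr _ mr.
have [d d0 dP] := resolvent_bounded_near fm sm.
have [N Ns] : exists N : nat, s * 2 <= N%:R.
  by apply: complex_le_nat; rewrite mulr_ge0// (fsball_ge0 sm).
have : U [set n | (N <= n)%N] by apply: FU; exists N.
move=> /(filterI (lm d d0)) /filter_ex[n [/= mn Nn]].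
have [_] := lP n; apply; apply: fsball_le (dP _ mn).
by rewrite (le_trans Ns)// ler_nat.
Qed.

End NaturalSpectrum.

(** * Cauchy's formula through means over roots *)

Section Cauchy.
Variables (R : realType) (G : groupType).
Local Notation C := R[i].
Implicit Types (f g h u v : G -> C) (r s c e t z : C) (x y : G).
Local Notation fs := (fourier_stieltjes R G).

(** Unlike [fsballZ], this costs no factor 2, so convex combinations stay in the ball. *)
Lemma fsball_pscale c r f : 0 <= c -> fsball r f ->
  fsball (c * r) (fun x => c * f x).
Proof.
move=> c0 rf; have /(_ G)/fsballM/(_ rf) := @fsball_expi_cst R _ 0 c c0.
by apply: eq_fsball => x; rewrite fctE mul1r.
Qed.

(* The mean of [h] over the [2 ^ k]-th roots of [t]. *)
Fixpoint root_mean (k : nat) (h : C -> C) t : C :=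
  if k is k'.+1 then
    2^-1 * (root_mean k' h (sqrtC t) + root_mean k' h (- sqrtC t))
  else h t.

(** All the points averaged have the same [2 ^ k]-th power [t]. *)
Lemma root_meanM k (a h : C -> C) t :
  root_mean k (fun z => a (z ^+ (2 ^ k)) * h z) t = a t * root_mean k h t.
Proof.
elim: k a t => [|k IH] a t; first by rewrite /= expr1.
have e : (fun z => a (z ^+ (2 ^ k.+1)) * h z)
       = (fun z => (fun w => a (w ^+ 2)) (z ^+ (2 ^ k)) * h z).
  by apply/funext => z; rewrite expnSr exprM.
by rewrite [LHS]/= e !(IH (fun w => a (w ^+ 2))) sqrrN sqrtCK -mulrDr mulrCA.
Qed.

(** A discrete Cauchy formula. The induction adds the partial fractions at the two square roots of
    [t]; when [n >= 2 ^ k], the factor [w ^+ (2 ^ k)] is first pulled out of the mean. *)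
Lemma root_mean_cauchy k n z t : (n < 2 ^ k)%N -> t - z ^+ (2 ^ k) != 0 ->
  root_mean k (fun w => w ^+ n.+1 / (w - z)) t
    = t * z ^+ n / (t - z ^+ (2 ^ k)).
Proof.
elim: k n t => [|k IH] n t.
  by rewrite expn0 ltnS leqn0 => /eqP ->; rewrite /= !expr1 expr0 mulr1.
rewrite expnSr exprM; set T := z ^+ (2 ^ k) => nk.
rewrite -{1}(sqrtCK t) subr_sqr mulf_eq0 negb_or => /andP[tT1 tT2].
have tT3 : - sqrtC t - T != 0 by rewrite -opprD oppr_eq0.
rewrite -[in RHS](sqrtCK t).
have tT4 : sqrtC t ^+ 2 - T ^+ 2 != 0 by rewrite subr_sqr mulf_neq0.
have [nk'|kn] := ltnP n (2 ^ k).
  rewrite /= !IH// -/T; field.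
  by rewrite tT1 tT3 tT4.
have e : (fun w => w ^+ n.+1 / (w - z)) =
    (fun w => w ^+ (2 ^ k) * (w ^+ (n - 2 ^ k).+1 / (w - z))).
  by apply/funext => w; rewrite mulrA -exprD addnS subnKC.
have nk'' : (n - 2 ^ k < 2 ^ k)%N by rewrite ltn_subLR// addnn -muln2.
rewrite /= e !(root_meanM k id) !IH// -/T -[in RHS](subnKC kn) exprD -/T.
field.
by rewrite tT1 tT3 tT4.
Qed.

Lemma fsball_root_mean k c r (h : C -> G -> C) t : 0 <= r ->
  (forall z, `|z| = r -> fsball c (h z)) -> `|t| = r ^+ (2 ^ k) ->
  fsball c (fun x => root_mean k (h^~ x) t).
Proof.
move=> r0 hc; elim: k t => [|k IH] t; first by rewrite expr1 => /hc.
rewrite expnSr exprM => tr.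
have sr : `|sqrtC t| = r ^+ (2 ^ k).
  apply/eqP; rewrite -(@eqrXn2 _ 2)// ?exprn_ge0//.
  by rewrite -normrX sqrtCK tr.
have h2 : 0 <= 2^-1 :> C by rewrite invr_ge0.
have := fsball_pscale h2 (fsballD (IH _ sr) (IH (- sqrtC t) _)).
rewrite -mulr2n -[c *+ 2]mulr_natl mulKf ?pnatr_eq0//; apply.
by rewrite normrN.
Qed.

Lemma small_quotient c e z : 0 <= c -> 0 < e -> `|z| < 1 ->
  exists N, forall n, (N <= n)%N -> c * (`|z ^+ n| / `|1 - z ^+ n|) < e.
Proof.
move=> c0 e0 z1; have ce0 : 0 < c + e by rewrite ltr_wpDl.
(* The bound [y < e / (c + e)] is exactly [c * y < e * (1 - y)]. *)
have [N Nz] := expr_lt (normr_ge0 z) z1 (divr_gt0 e0 ce0).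
exists N => n /Nz zn; rewrite normrX.
set y := `|z| ^+ n in zn *.
have y1 : y < 1 by rewrite (lt_le_trans zn)// ler_pdivrMr// mul1r lerDr.
have d1 : 1 - y <= `|1 - z ^+ n|.
  by have := lerB_dist 1 (z ^+ n); rewrite normr1 normrX.
have d0 : 0 < 1 - y by rewrite subr_gt0.
rewrite mulrA ltr_pdivrMr ?(lt_le_trans d0)//.
rewrite (lt_le_trans (_ : _ < e * (1 - y)))// ?ler_pM2l//.
by move: zn; rewrite ltr_pdivlMr// mulrBr mulr1 ltrBrDr mulrC mulrDl (mulrC e).
Qed.

(** With [w] the one of [z / r] and [r / z] of modulus less than 1, the difference is
    [z^n w^m / (1 - w^m)] up to sign. *)
Lemma cauchy_limit n r e z : 0 < r -> 0 < e -> `|z| != r ->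
  exists N, forall m, (N <= m)%N -> r ^+ m - z ^+ m != 0 /\
    `|(if `|z| < r then z ^+ n else 0)
      - r ^+ m * z ^+ n / (r ^+ m - z ^+ m)| < e.
Proof.
move=> r0 e0 zr; have rN0 : r != 0 by rewrite lt0r_neq0.
have small (w : C) m : `|w| < 1 -> (0 < m)%N -> 1 - w ^+ m != 0.
  move=> w1 m0; rewrite subr_eq0; apply/eqP => /(congr1 Num.norm).
  rewrite normr1 normrX => w1'; have := exprn_ilt1 m (normr_ge0 w) w1.
  by rewrite -w1' ltxx -lt0n m0.
have [zlt|zge] := boolP (`|z| < r).
  pose w := z / r; have w1 : `|w| < 1.
    by rewrite normrM normfV (gtr0_norm r0) ltr_pdivrMr// mul1r.
  have zE : z = w * r by rewrite mulfVK.
  have [N Nw] := small_quotient (normr_ge0 (z ^+ n)) e0 w1.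
  exists N.+1 => m Nm; have m0 : (0 < m)%N by case: m Nm.
  have rm0 : r ^+ m != 0 by rewrite expf_neq0.
  have wm0 := small w m w1 m0.
  have -> : r ^+ m - z ^+ m = r ^+ m * (1 - w ^+ m).
    by rewrite zE exprMn; ring.
  split; first by rewrite mulf_neq0.
  have := Nw m (ltnW Nm); congr (_ < _).
  rewrite -normf_div -normrM -normrN; congr Num.norm.
  by set y := w ^+ m; set T := r ^+ m; field; rewrite wm0 rm0.
have rlt : r < `|z|.
  by rewrite real_ltNge ?normr_real ?gtr0_real// le_eqVlt negb_or zr.
have z0 : z != 0 by rewrite -normr_gt0 (lt_trans r0).
have [w w1 rE] : exists2 w : C, `|w| < 1 & r = w * z.
  exists (r / z); last by rewrite mulfVK.
  by rewrite normrM normfV (gtr0_norm r0) ltr_pdivrMr ?mul1r// normr_gt0.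
have [N Nw] := small_quotient (normr_ge0 (z ^+ n)) e0 w1.
exists N.+1 => m Nm; have m0 : (0 < m)%N by case: m Nm.
have zm0 : z ^+ m != 0 by rewrite expf_neq0.
have wm0 := small w m w1 m0.
have -> : r ^+ m - z ^+ m = - (z ^+ m * (1 - w ^+ m)).
  by rewrite rE exprMn; ring.
split; first by rewrite oppr_eq0 mulf_neq0.
have := Nw m (ltnW Nm); congr (_ < _).
rewrite -normf_div -normrM; congr Num.norm.
rewrite rE exprMn; set y := w ^+ m in wm0 *; set T := z ^+ m in zm0 *.
by field; rewrite wm0 zm0.
Qed.

Lemma natural_spectrum_quasinilpotent f :
  c0 R G f -> natural_spectrum R G f -> quasinilpotent f.
Proof.
move=> f0 [ff sf] e e0.
have [r [r0 re fr]] := circle_avoiding_range f0 e0.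
(* On this circle the resolvent lies in B(G), because a nonzero point of the spectrum is a value of
   [f]. *)
have [l|c cP] := @resolvent_bounded_circle _ _ f r.
  move=> lr; have fl x : f x != l.
    by apply/eqP => fl; have := fr x; rewrite fl lr eqxx.
  split=> //.
  have l0 : l != 0 by rewrite -normr_gt0 lr.
  have : ~ spectrum f l.
    by rewrite sf => /(closure_range_c0 f0 l0)[x _]; apply/eqP.
  move=> /contrapT[g gP fg].
  have -> : (fun x => (l - f x)^-1) = (fun=> -1) * g.
    apply/funext => x; have := congr1 (fun h => h x) fg; rewrite !fctE => e1.
    have flx : f x - l != 0 by rewrite subr_eq0.
    apply: (mulfI flx).
    by rewrite mulrCA e1 mulr1 -[l - f x]opprB invrN mulrN divff.
  by apply: fsM => //; exact: fs_cst.
exists (2 * r * c); apply: (@growth_le _ _ _ r); [exact: ltW|done|move=> n].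
(* This truncation of [f^n] is the pointwise limit of the Cauchy means, and differs from [f^n] at
   finitely many points only. *)
exists (fun x => if `|f x| < r then f x ^+ n else 0); last first.
  apply: sub_finite_set (f0 r r0) => x /=.
  rewrite exprfctE; have [|nr _] := boolP (`|f x| < r); first by rewrite eqxx.
  by rewrite real_leNgt// ?gtr0_real ?normr_real//.
have hb z : `|z| = r -> fsball (2 * r ^+ n.+1 * c)
    (fun x => z ^+ n.+1 / (z - f x)).
  by move=> zr; have := fsballZ (z ^+ n.+1) (cP z zr); rewrite normrX zr.
have -> : 2 * r * c * r ^+ n = 2 * r ^+ n.+1 * c by rewrite exprS; ring.
apply: closed_fsball => t d d0.
have [N Nt] : exists N, forall m, (N <= m)%N -> forall x, x \in t ->
    r ^+ m - f x ^+ m != 0 /\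
    `|(if `|f x| < r then f x ^+ n else 0)
       - r ^+ m * f x ^+ n / (r ^+ m - f x ^+ m)| < d.
  elim: t => [|y t [N Nt]]; first by exists 0%N.
  have [M My] := cauchy_limit n r0 d0 (fr y).
  exists (maxn M N) => m; rewrite geq_max => /andP[Mm Nm] x.
  by rewrite inE => /predU1P[->|xt]; [exact: My|exact: Nt].
pose k := maxn n N.
(* The mean needs [n < 2 ^ k] for the discrete formula and [N <= 2 ^ k] for the precision [d] on
   [t]. *)
have nk : (n < 2 ^ k)%N.
  by apply: leq_ltn_trans (ltn_expl k _); rewrite ?leq_maxl.
have Nk : (N <= 2 ^ k)%N.
  by apply: ltnW; apply: leq_ltn_trans (ltn_expl k _); rewrite ?leq_maxr.
exists (fun x => root_mean k (fun z => z ^+ n.+1 / (z - f x)) (r ^+ (2 ^ k))).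
  apply: fsball_root_mean hb _; first exact: ltW.
  by rewrite normrX gtr0_norm.
move=> x xt; have [n0] := Nt _ Nk x xt.
by rewrite root_mean_cauchy.
Qed.
End Cauchy.

(** * Separation of a point from a convex set in finitely many coordinates *)

(** The normal [w] joins an almost nearest point [p] of [K] to [u]. If some [f] in [K] went too far
    in the direction [w], a step from [p] towards [f] would bring the squared distance below its
    infimum. *)
Lemma convex_separation (R : realType) (T : Type) (s : seq T)
    (K : set (T -> R)) (u : T -> R) (M d : R) :
  K !=set0 ->
  (forall f g t, K f -> K g -> 0 <= t <= 1 ->
     K (fun x => f x + t * (g x - f x))) ->
  (forall f x, K f -> `|f x| <= M) -> 0 < d ->
  (forall f, K f -> d <= \sum_(x <- s) (u x - f x) ^+ 2) ->
  exists (w : T -> R) (a : R),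
    (forall f, K f -> \sum_(x <- s) w x * f x <= a) /\
    a < \sum_(x <- s) w x * u x.
Proof.
move=> [f0 Kf0] Kc KM d0 Kd.
pose q f := \sum_(x <- s) (u x - f x) ^+ 2.
have hi : has_inf (q @` K).
  by split; [exists (q f0), f0|exists d => _ [f Kf <-]; exact: Kd].
(* [B] bounds the squared diameter of [K], and [t] is the length of the step. Taking [p] within
   [t^2 B] of the infimum gives [S <= t B <= d / 2], whereas [u] lies beyond [p] by at least [d]. *)
pose B := 1 + \sum_(x <- s) (2 * M) ^+ 2.
have B0 : 0 < B by rewrite ltr_wpDr// sumr_ge0// => x _; exact: sqr_ge0.
pose t := Num.min 1 (d / (2 * B)).
have t0 : 0 < t by rewrite lt_min ltr01 divr_gt0// mulr_gt0.
have tB : t * B <= d / 2.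
  have -> : d / 2 = d / (2 * B) * B by field; rewrite gt_eqF.
  by rewrite ler_pM2r// ge_min lexx orbT.
have [_ [p Kp <-] qp] := inf_adherent (mulr_gt0 (exprn_gt0 2 t0) B0) hi.
pose w x := u x - p x.
exists w, (\sum_(x <- s) w x * p x + d / 2); split; last first.
  have -> : \sum_(x <- s) w x * u x = \sum_(x <- s) w x * p x + q p.
    by rewrite -big_split; apply: eq_bigr => x _; rewrite /w/=; ring.
  by rewrite ltrD2l; have := Kd p Kp; rewrite -/(q p); lra.
move=> f Kf; rewrite -lerBlDl.
set S := _ - _.
have SE : S = \sum_(x <- s) w x * (f x - p x).
  by rewrite /S -sumrB; apply: eq_bigr => x _; ring.
pose N := \sum_(x <- s) (f x - p x) ^+ 2.
have NB : N <= B.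
  rewrite /B -[N]add0r lerD// ler_sum// => x _.
  have fp : `|f x - p x| <= 2 * M.
    by rewrite (le_trans (ler_normB _ _))// mulrDl mul1r lerD// KM.
  rewrite -(real_normK (num_real (f x - p x))) lerXn2r ?nnegrE//.
  exact: le_trans fp.
have qt : q (fun x => p x + t * (f x - p x)) = q p - 2 * t * S + t ^+ 2 * N.
  rewrite SE /q /N !mulr_sumr -sumrB -big_split; apply: eq_bigr => x _ /=.
  by rewrite /w; ring.
have : inf (q @` K) <= q (fun x => p x + t * (f x - p x)).
  apply: ge_inf; first exact: hi.2.
  exists (fun x => p x + t * (f x - p x)) => //; apply: Kc => //.
  by rewrite ltW//= ge_min lexx.
rewrite qt => H.
have H2 : 2 * t * S <= t ^+ 2 * B + t ^+ 2 * B.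
  have : t ^+ 2 * N <= t ^+ 2 * B by rewrite ler_pM2l// exprn_gt0.
  lra.
have : S <= t * B; last by move/le_trans; apply.
rewrite -(ler_pM2l (mulr_gt0 (ltr0Sn R 1) t0)).
by apply: (le_trans H2); rewrite le_eqVlt; apply/orP; left; apply/eqP; ring.
Qed.

(** * Finitely supported functionals separating from [D_r] *)

Section Duality.
Variables (R : realType) (G : groupType).
Local Notation C := R[i].
Implicit Types (f g h u v : G -> C) (x y : G).

Lemma fsball_separation (r : R) u : 0 < r -> ~ fsball r%:C%C u ->
  exists (F : {fset G}) (c : G -> C) (a : R), [/\ 0 < a,
    forall f, fsball r%:C%C f -> complex.Re (\sum_(x <- F) c x * f x) <= a
    & a < complex.Re (\sum_(x <- F) c x * u x)].
Proof.
move=> r0 nu.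
(* By [closed_fsball], finitely many points already keep [u] at a fixed distance from the ball. *)
have [s [d d0 sd]] : exists s : seq G, exists2 d : R, 0 < d &
    forall g, fsball r%:C%C g -> exists2 x, x \in s & d%:C%C <= `|u x - g x|.
  apply: contrapT => ns; apply: nu; apply: closed_fsball => s e.
  move=> /gt0_real_complex[d d0 ->]; apply: contrapT => ng; apply: ns.
  exists s, d => // g gr; apply: contrapT => nx; apply: ng; exists g => // x xs.
  rewrite real_ltNge ?normr_real//; last by apply/complex_realP; exists d.
  by apply/negP => h; apply: nx; exists x.
pose F := [fset x in s]%fset.
pose cv (h : G * bool -> R) x : C := Complex (h (x, true)) (h (x, false)).
pose rv f (k : G * bool) :=
  if k.2 then complex.Re (f k.1) else complex.Im (f k.1).
have cvK f : cv (rv f) = f by apply/funext => x; rewrite /cv /rv/=; case: (f x).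
pose t := [seq (x, true) | x <- F] ++ [seq (x, false) | x <- F].
have tE (h : G * bool -> R) :
    \sum_(k <- t) h k = \sum_(x <- F) (h (x, true) + h (x, false)).
  by rewrite big_cat !big_map big_split.
have Re_mul (w : G * bool -> R) f : complex.Re (\sum_(x <- F)
    Complex (w (x, true)) (- w (x, false)) * f x) = \sum_(k <- t) w k * rv f k.
  rewrite tE; elim/big_rec2: _ => // x a b _ <-.
  by case: b => b1 b2; rewrite /rv/=; case: (f x) => f1 f2 /=; ring.
pose K := [set h | fsball r%:C%C (cv h)].
have [|f g e Kf Kg /andP[e0 e1]|h [x b] Kh|||w [a [wa au]]] :=
  @convex_separation R _ t K (rv u) r (d ^+ 2).
- exists (fun=> 0); rewrite /K/=.
  by apply: eq_fsball (@fsball0 R G _ _) => //; rewrite ler0c ltW.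
- have e0' : 0 <= e%:C%C :> C by rewrite ler0c.
  have e1' : 0 <= (1 - e)%:C%C :> C by rewrite ler0c subr_ge0.
  have := fsballD (fsball_pscale e1' Kf) (fsball_pscale e0' Kg).
  rewrite -mulrDl -rmorphD subrK mul1r; apply: eq_fsball => x.
  rewrite fctE /cv; apply/eqP; rewrite eq_complex/=.
  by apply/andP; split; apply/eqP; ring.
- have := fsball_norm x Kh; case: b => hx; rewrite -lecR; apply: le_trans hx.
    exact: normc_ge_Re (cv h x).
  exact: normc_ge_Im (cv h x).
- exact: exprn_gt0.
- move=> h Kh; have [x xs dx] := sd _ Kh.
  rewrite tE (bigD1_seq x) ?fset_uniq ?inE//=.
  rewrite ler_wpDr ?sumr_ge0// => [y _|]; first by rewrite addr_ge0 ?sqr_ge0.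
  rewrite -lecR rmorphXn /=.
  have -> : ((rv u (x, true) - h (x, true)) ^+ 2 +
    (rv u (x, false) - h (x, false)) ^+ 2)%:C%C = `|u x - cv h x| ^+ 2.
    by rewrite -add_Re2_Im2 /rv /cv/=; case: (u x).
  by rewrite lerXn2r ?nnegrE// ler0c ltW.
(* The minus sign makes [Re (c f)] the real scalar product of [w] with the coordinates of [f]. *)
pose c x : C := Complex (w (x, true)) (- w (x, false)).
have a0 : 0 <= a.
  have := wa (fun=> 0); rewrite big1 => [|x _]; last by rewrite mulr0.
  apply; apply: eq_fsball (@fsball0 R G _ _) => //; rewrite ler0c ltW//.
(* Only [0 <= a] is known; the midpoint is a strictly positive separating level. *)
pose b := (a + \sum_(k <- t) w k * rv u k) / 2.
exists F, c, b; split.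
- rewrite /b; lra.
- move=> f fr; rewrite Re_mul (le_trans (wa (rv f) _))//.
    by rewrite /K/= cvK.
  by rewrite /b; lra.
- by rewrite Re_mul /b; lra.
Qed.

(** * The numerical radius in a Hilbert space *)

Section Representation.
Variables (H : hilbert R).
Local Notation "''[' v , w ]" := (inner H v w).

Lemma sum_expi : \sum_(k < 4) 'i ^+ k = 0 :> C.
Proof.
rewrite !big_ord_recl big_ord0 /= /bump /= expr0 expr1 sqrCi (exprD _ 1 2).
by rewrite expr1 sqrCi; ring.
Qed.

Lemma sum_expi_sqr : \sum_(k < 4) ('i ^+ k) ^+ 2 = 0 :> C.
Proof.
under eq_bigr do rewrite -exprM mulnC exprM sqrCi.
by rewrite !big_ord_recl big_ord0 /= /bump /=; ring.
Qed.

Lemma innerZl (b : C) (v w : H) : '[b *: v, w] = b * '[v, w].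
Proof. exact: linearZl_LR. Qed.

Lemma innerZr (b : C) (v w : H) : '[v, b *: w] = b^* * '[v, w].
Proof. exact: linearZr_LR. Qed.

Lemma inner_add (s t : C) (v w v' w' : H) :
  '[v + s *: w, v' + t *: w'] = '[v, v'] + t^* * '[v, w']
    + s * '[w, v'] + s * t^* * '[w, w'].
Proof.
transitivity ('[v, v'] + '[v, t *: w'] + ('[s *: w, v'] + '[s *: w, t *: w'])).
  by rewrite linearDl !linearDr.
by rewrite !innerZl !innerZr; ring.
Qed.

Lemma innerZ_norm (b : C) (v : H) : '[b *: v, b *: v] = `|b| ^+ 2 * `|v| ^+ 2.
Proof. by rewrite dnormZ innerE. Qed.

Lemma inner_expi_norm k (v w : H) : '[v + 'i ^+ k *: w, v + 'i ^+ k *: w]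
  = `|v| ^+ 2 + `|w| ^+ 2 + (('i ^+ k)^* * '[v, w] + 'i ^+ k * '[v, w]^*).
Proof.
rewrite dnormD -!innerE innerE innerZ_norm norm_expi expr1n mul1r innerZr.
by rewrite rmorphM /= conjCK innerE.
Qed.

(* By polarization, the numerical radius controls the operator norm. *)
Lemma numerical_radius (T : H -> H) (b : C) (v : H) :
  (forall (s : C) (v w : H), T (v + s *: w) = T v + s *: T w) -> 0 <= b ->
  (forall w : H, `|'[T w, w]| <= b * `|w| ^+ 2) -> `|v| <= 1 -> `|T v| <= 2 * b.
Proof.
move=> TL b0 Tb v1.
have [->|Tv0] := eqVneq (T v) 0; first by rewrite normr0 mulr_ge0.
have n0 : 0 < `|T v| by rewrite normr_gt0.
have [w w1 Tvw] : exists2 w : H, `|w| = 1 & '[T v, w] = `|T v|.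
  exists (`|T v|^-1 *: T v).
    by rewrite normrZ normfV normr_id mulVf// lt0r_neq0.
  rewrite innerZr innerE fmorphV /= (conj_Creal (normr_real _)) expr2 mulKf//.
  exact: lt0r_neq0.
have polar : 4 * '[T v, w] = \sum_(k < 4) 'i ^+ k *
    '[T (v + 'i ^+ k *: w), v + 'i ^+ k *: w].
  have e (k : nat) : 'i ^+ k * '[T (v + 'i ^+ k *: w), v + 'i ^+ k *: w] =
      'i ^+ k * '[T v, v] + ('i ^+ k * ('i ^+ k)^*) * '[T v, w]
      + ('i ^+ k) ^+ 2 * '[T w, v]
      + ('i ^+ k * ('i ^+ k)^*) * 'i ^+ k * '[T w, w].
    by rewrite TL inner_add; ring.
  under eq_bigr do rewrite e -normCK norm_expi expr1n !mul1r.
  rewrite !big_split /= -!mulr_suml sum_expi sum_expi_sqr !mul0r !addr0 add0r.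
  by rewrite sumr_const card_ord mulr_natl.
(* Each polarization term is bounded through the numerical radius; summed over the four powers of i,
   the cross terms cancel. *)
have : 4 * `|T v| <= \sum_(k < 4) b * (`|v| ^+ 2 + `|w| ^+ 2 +
    (('i ^+ k)^* * '[v, w] + 'i ^+ k * '[v, w]^*)).
  have <- : `|4 * '[T v, w]| = 4 * `|T v|.
    by rewrite Tvw normrM normr_id normr_nat.
  rewrite polar (le_trans (ler_norm_sum _ _ _))// ler_sum// => k _.
  by rewrite normrM norm_expi mul1r (le_trans (Tb _))// -innerE inner_expi_norm.
rewrite -mulr_sumr !big_split /= -!mulr_suml -rmorph_sum sum_expi.
rewrite rmorph0 !mul0r !addr0.
rewrite w1 !sumr_const card_ord => h.
have {h} : `|T v| <= b * (`|v| ^+ 2 + 1).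
  rewrite -(@ler_pM2l _ 4)// (le_trans h)// le_eqVlt; apply/orP; left.
  by apply/eqP; ring.
move/le_trans; apply; rewrite mulrC ler_wpM2r// -[2]/(1 + 1) lerD2r.
by rewrite exprn_ile1.
Qed.

End Representation.

(** * The norm of B(G) controls the balls [D_r] *)

Lemma positive_definite_coefficient (pi : unitary_rep R G) (w : rep_space pi) :
  positive_definite (fun x => inner (rep_space pi) (pi x w) w).
Proof.
move=> n x c; pose z := \sum_(j < n) c j *: pi (x j) w.
suff -> : \sum_(i < n) \sum_(j < n) (c i)^* * c j *
    inner (rep_space pi) (pi ((x i)^-1 * x j)%g w) w = inner (rep_space pi) z z.
  by rewrite innerE exprn_ge0.
rewrite /z linear_sumr; apply: eq_bigr => i _.
rewrite linear_sumlz; apply: eq_bigr => j _.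
transitivity ((c i)^* * (c j * inner (rep_space pi) (pi (x j) w) (pi (x i) w))).
  rewrite -mulrA -(rep_unitary (x i) (pi ((x i)^-1 * x j)%g w)) -rep_actM.
  by rewrite mulgA mulgV mul1g.
transitivity
  (inner (rep_space pi) (c j *: pi (x j) w) (c i *: pi (x i) w)) => //.
by rewrite innerZl innerZr mulrCA.
Qed.

(** Normalised to the value [r] at [1], [phi] stays in the ball when multiplied by any power of i.
    Real and imaginary parts of the functional are thus at most [a] in absolute value, whence
    [2 * a]. *)
Lemma functional_positive_definite (F : {fset G}) (c : G -> C) (a r : R) phi :
  0 < r -> 0 <= a ->
  (forall f, fsball r%:C%C f -> complex.Re (\sum_(x <- F) c x * f x) <= a) ->
  positive_definite phi ->
  `|\sum_(x <- F) c x * phi x| <= (2 * a / r)%:C%C * phi 1%g.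
Proof.
move=> r0 a0 ca phiP; have p0 := positive_definite1_ge0 phiP.
have [p1|pN0] := eqVneq (phi 1%g) 0.
  rewrite p1 mulr0 big1 ?normr0// => x _.
  have := positive_definite_norm x phiP; rewrite p1 normr_le0 => /eqP ->.
  by rewrite mulr0.
have {}p0 : 0 < phi 1%g by rewrite lt_def pN0.
have [p pp pE] := gt0_real_complex p0.
have rp0 : 0 <= (r / p)%:C%C :> C by rewrite ler0c divr_ge0// ltW.
pose S := (r / p)%:C%C * \sum_(x <- F) c x * phi x.
have ReS k : complex.Re ('i ^+ k * S) <= a.
  have := ca (fun x => (r / p)%:C%C * ('i ^+ k * phi x)).
  have /[swap]/[apply] :
      fsball r%:C%C (fun x => (r / p)%:C%C * ('i ^+ k * phi x)).
    have := fsball_pscale rp0 (fsball_expi k phiP).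
    by rewrite pE -rmorphM /= divfK ?gt_eqF.
  congr (complex.Re _ <= _); rewrite /S !mulr_sumr; apply: eq_bigr => x _.
  by ring.
have S2 : `|S| <= (2 * a)%:C%C.
  apply: (le_trans (normc_le_Re_Im _)); rewrite lecR.
  have := ReS 0%N; have := ReS 1%N; have := ReS 2%N; have := ReS 3%N.
  rewrite (exprD _ 1 2) expr0 expr1 sqrCi mulrN1 !mulNr mul1r -complexiE.
  case: (S) => s1 s2 /= h3 h2 h1 h0.
  by rewrite mulrDl mul1r lerD// ler_norml; lra.
have q0 : 0 < (r / p)%:C%C :> C by rewrite ltcE/= eqxx divr_gt0.
rewrite -(ler_pM2l q0) -{1}(ger0_norm rp0) -normrM pE (le_trans S2)//.
rewrite -!rmorphM lecR le_eqVlt; apply/orP; left; apply/eqP.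
by field; rewrite !gt_eqF.
Qed.

Lemma big_fsfun (V : nmodType) (F : {fset G}) (c : G -> C)
    (op : C -> G -> V) : (forall x, op 0 x = 0) ->
  let c' : {fsfun G -> C with 0} := [fsfun x in F => c x]%fsfun in
  \sum_(x <- finsupp c') op (c' x) x = \sum_(x <- F) op (c x) x.
Proof.
move=> op0 c'; rewrite (big_fset_incl _ (B := F)).
- by apply: eq_big_seq => x xF; rewrite fsfunE xF.
- exact: finsupp_sub.
- by move=> x xF; rewrite memNfinsupp => /eqP ->.
Qed.

(** A separating functional has numerical radius at most [2 a / r] in every unitary representation,
    hence operator norm at most [4 a / r]. Scaled by [k = r / (4 a)] it enters the unit ball of
    C*(G), and its value at [u] is still at least [r / 4] in modulus. *)
Lemma fs_norm_fsball (r : R) u : 0 < r ->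
  (fs_norm u < (r / 4)%:E)%E -> fsball r%:C%C u.
Proof.
move=> r0 ur; apply: contrapT => nu; move: ur; apply/negP; rewrite -leNgt.
have [F [c [a [a0 ca au]]]] := fsball_separation r0 nu.
pose k : R := r / (4 * a).
have k0 : 0 < k by rewrite divr_gt0// mulr_gt0.
have kC : 0 <= k%:C%C :> C by rewrite ler0c ltW.
pose c' : {fsfun G -> C with 0} := [fsfun x in F => k%:C%C * c x]%fsfun.
have c'1 : (cstar_norm c' <= 1)%E.
  apply: ge_ereal_sup => _ [pi [v [v1 ->]]]; rewrite lee_fin.
  rewrite (@big_fsfun _ F (fun x => k%:C%C * c x) (fun a x => a *: pi x v));
    last by move=> x; rewrite scale0r.
  under eq_bigr do rewrite -scalerA.
  rewrite -scaler_sumr.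
  pose T (w : rep_space pi) : rep_space pi := \sum_(x <- F) c x *: pi x w.
  have TL (s : C) (w z : rep_space pi) : T (w + s *: z) = T w + s *: T z.
    rewrite /T scaler_sumr -big_split; apply: eq_bigr => x _ /=.
    by rewrite linearD linearZ /= scalerDr !scalerA mulrC.
  have b0 : 0 <= (2 * a / r)%:C%C :> C.
    by rewrite ler0c divr_ge0 ?mulr_ge0// ltW.
  have Tb (w : rep_space pi) :
      `|inner (rep_space pi) (T w) w| <= (2 * a / r)%:C%C * `|w| ^+ 2.
    have := functional_positive_definite r0 (ltW a0) ca
      (positive_definite_coefficient w).
    rewrite rep_act1 innerE; congr (`| _ | <= _).
    rewrite /T linear_sumlz; apply: eq_bigr => x _.
    by rewrite -innerZl.
  have := numerical_radius TL b0 Tb v1; rewrite -/(T v) => Tv.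
  rewrite /rnorm normrZ (ger0_norm kC).
  have : k%:C%C * `|T v| <= k%:C%C * (2 * (2 * a / r)%:C%C).
    by rewrite ler_pM2l ?ltcE/= ?eqxx.
  rewrite lecE => /andP[_]; move/le_trans; apply=> /=.
  rewrite le_eqVlt; apply/orP; left; apply/eqP; rewrite /k.
  by field; rewrite !gt_eqF.
apply: le_trans (ereal_sup_ubound _); last by exists c'.
rewrite lee_fin (@big_fsfun _ F (fun x => k%:C%C * c x) (fun a x => a * u x));
  last by move=> x; rewrite mul0r.
under eq_bigr do rewrite -mulrA.
rewrite -mulr_sumr /rnorm normrM (ger0_norm kC).
set S := \sum_(x <- F) _ in au *.
have : k%:C%C * (complex.Re S)%:C%C <= k%:C%C * `|S|.
  rewrite ler_pM2l ?ltcE/= ?eqxx//.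
  by apply: le_trans (normc_ge_Re S); rewrite lecR ler_norm.
rewrite lecE => /andP[_]; rewrite /= !mul0r ?mulr0 !subr0; apply: le_trans.
have -> : r / 4 = k * a by rewrite /k; field; rewrite gt_eqF.
by rewrite ler_pM2l// ltW.
Qed.

End Duality.

(** * Characters of ideals containing the point masses *)

Section Characters.
Variables (R : realType) (G : groupType).
Local Notation C := R[i].
Implicit Types (f g h u v : G -> C) (r s c e : C) (x y : G).
Local Notation fs := (fourier_stieltjes R G).

Lemma finite_support_ideal (A : set (G -> C)) h :
  ideal A -> (forall y, A (fun x => (x == y)%:R)) ->
  finite_set [set x | h x != 0] -> A h.
Proof.
move=> [_ A0 AD AM] Ad /finite_supportE[t ->].
elim: t => [|y t IH]; first by rewrite big_nil.
rewrite big_cons; have := AD 1 _ _ (AM _ _ (fs_cst G (h y)) (Ad y)) IH.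
by rewrite scale1r.
Qed.

Lemma character_dichotomy (A : set (G -> C)) (chi : A -> C) :
  ideal A -> (forall y, A (fun x => (x == y)%:R)) -> Delta A chi ->
  (exists x, chi = point_eval A x) \/
  (forall f : A, quasinilpotent (val f) -> chi f = 0).
Proof.
move=> Ai Ad [chiD chiM _]; have [Afs A0 AD AM] := Ai.
have lift f : A f -> exists k : A, val k = f.
  by move=> Af; exists (SigSub (mem_set Af)).
have valP (k : A) : A (val k) by exact: set_mem (valP k).
have [[y]|nd] := pselect (exists y,
    exists2 k : A, val k = (fun x => (x == y)%:R) & chi k != 0).
  move=> [k kE k0]; left; exists y; apply/funext => f.
  (* The product of [f] with the mass at [y] is [f y] times that mass, so [chi f = f y]. Linearity
     is stated for [a *: f + g], hence the zero element [z]. *)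
  have [p pE] := lift _ (AM _ _ (Afs _ (valP f)) (valP k)).
  have [z zE] := lift _ A0.
  have chiz : chi z = 0.
    have := chiD (-1) z z z; rewrite zE scaleN1r addNr => /(_ erefl).
    by rewrite mulN1r addNr.
  have e1 := chiM _ _ _ pE.
  have : chi p = (val f y) * chi k + chi z.
    apply: chiD; rewrite pE kE zE; apply/funext => x; rewrite !fctE addr0.
    by have [->|] := eqVneq x y; rewrite ?mulr0// scaler0.
  by rewrite e1 chiz addr0 => /(mulIf k0).
right=> f qf; apply: contrapT => /eqP f0.
have chi0 (k : A) : val k = 0 -> chi k = 0.
  move=> kE; have := chiD (-1) k k k; rewrite kE scaleN1r addNr => /(_ erefl).
  by rewrite mulN1r addNr.
have chid y (k : A) : val k = (fun x => (x == y)%:R) -> chi k = 0.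
  by move=> kE; apply: contrapT => /eqP k0; apply: nd; exists y, k.
have chisum t (a : G -> C) (k : A) :
    val k = \sum_(y <- t) (fun=> a y) * (fun x => (x == y)%:R) -> chi k = 0.
  elim: t k => [|y t IH] k; first by rewrite big_nil; exact: chi0.
  rewrite big_cons => kE; have [d dE] := lift _ (Ad y).
  have Am : A (\sum_(y <- t) (fun=> a y) * (fun x => (x == y)%:R)).
    elim: t {IH kE} => [|z t IH]; first by rewrite big_nil.
    rewrite big_cons; have := AD 1 _ _ (AM _ _ (fs_cst G (a z)) (Ad z)) IH.
    by rewrite scale1r.
  have [m mE] := lift _ Am.
  rewrite (chiD (a y) d m k) ?(chid y d)// ?(IH m)// ?mulr0 ?addr0//.
  by rewrite kE dE mE.
have chifin (k : A) : finite_set [set x | val k x != 0] -> chi k = 0.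
  by move=> /finite_supportE[t]; exact: chisum.
have chiX n : exists2 p : A, val p = val f ^+ n.+1 & chi p = chi f ^+ n.+1.
  elim: n => [|n [p pE chip]]; first by exists f; rewrite ?expr1.
  have [q qE] := lift _ (AM _ _ (Afs _ (valP f)) (valP p)).
  by exists q; rewrite ?(chiM _ _ _ qE) exprS ?chip// qE pE.
(* Here [chi] kills finitely supported functions. With [c = chi f], the function [v] is
   [(f / c) ^+ n.+1] up to such a function, so [chi v = 1]. *)
have [[|n] [r [v [// _ r1 rv fv]]]] := quasinilpotent_power qf f0.
have [p pE chip] := chiX n.
set l := chi f ^+ n.+1 in chip fv.
have l0 : l != 0 by rewrite expf_neq0.
have Ah : A (v - l^-1 *: val p).
  apply: finite_support_ideal => //; apply: sub_finite_set fv => x /=.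
  rewrite pE !fctE; apply: contra => /eqP ->.
  by rewrite [_ *: _](mulKf l0) subrr.
have [h hE] := lift _ Ah.
have chih : chi h = 0.
  apply: chifin; rewrite hE; apply: sub_finite_set fv => x /=.
  rewrite pE !fctE; apply: contra => /eqP ->.
  by rewrite [_ *: _](mulKf l0) subrr.
have Av : A v.
  by rewrite -(subrK (l^-1 *: val p) v) addrC; apply: AD => //; exact: valP.
have [k kE] := lift _ Av.
have chik : chi k = 1.
  rewrite (chiD l^-1 p h k) ?chih ?chip ?mulVf ?addr0//.
  by rewrite kE hE addrC subrK.
(* The ideal need not contain 1, so [t = v / (1 - v)] is used: [t = v + v t] would give
   [chi t = 1 + chi t]. *)
have wP := fsball_fs (neumann r1 rv).
have At := AM _ _ wP Av; have [t tE] := lift _ At.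
have [q qE] := lift _ (AM _ _ (Afs _ Av) At).
have : chi t = 1 * chi k + chi q.
  apply: chiD; rewrite tE kE qE scale1r; apply/funext => x; rewrite !fctE.
  have v1 : 1 - v x != 0.
    rewrite subr_eq0; apply/eqP => v1; have := fsball_norm x rv.
    by rewrite -v1 normr1 => /le_lt_trans/(_ r1); rewrite ltxx.
  by field.
rewrite (chiM k t q) ?qE ?kE ?tE// chik !mul1r => /eqP.
by rewrite -subr_eq0 opprD addrCA subrr addr0 oppr_eq0 oner_eq0.
Qed.
End Characters.

(** * The three assertions *)

Lemma ideal_fourier_stieltjes (R : realType) (G : groupType) :
  ideal (fourier_stieltjes R G).
Proof.
split=> //; first exact: fs_cst.
  by move=> a f g ff gf; apply: fsD => //; exact: (fsM (fs_cst G a)).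
by move=> f g; exact: fsM.
Qed.

Unset Implicit Arguments.
Set Strict Implicit.

Theorem theorem4p5 (R : realType) (G : groupType) :
  let B : set (G -> R[i]) := fourier_stieltjes R G in
  let I : set (G -> R[i]) := fourier_stieltjes0 R G `&` natural_spectrum R G in
  [/\ forall chi : B -> R[i], (Delta B `\` range (point_eval B)) chi ->
        forall f : B, I (val f) -> chi f = 0,
      ideal I /\ norm_closed I
    & set_bij [set: G] (Delta I) (point_eval I)].
Proof.
move=> B I.
have IP f : I f <-> B f /\ quasinilpotent f.
  split=> [[[fB f0] fN]|[fB fq]].
    by split=> //; exact: natural_spectrum_quasinilpotent.
  split; last exact: quasinilpotent_natural_spectrum.
  by split=> //; exact: quasinilpotent_c0.
have Bi : ideal B := ideal_fourier_stieltjes R G.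
have Id y : I (fun x => (x == y)%:R).
  apply/IP; split; first exact: fs_delta.
  apply: quasinilpotent_finite_support.
  apply: sub_finite_set (finite_set1 y) => x /=.
  by case: (eqVneq x y) => //; rewrite eqxx.
have Ii : ideal I.
  split.
  - by move=> f [[]].
  - apply/IP; split; first exact: fs_cst.
    apply: quasinilpotent_finite_support.
    by apply: (sub_finite_set _ (@finite_set0 G)) => x /=; rewrite eqxx.
  - move=> a f g /IP[fB fq] /IP[gB gq]; apply/IP; split.
      by have [_ _ + _] := Bi; apply.
    apply: quasinilpotentD gq.
    exact: (quasinilpotentM (fs_cst G a) fq).
  - move=> f g fB /IP[gB gq]; apply/IP; split; first exact: fsM.
    exact: quasinilpotentM.
split.
- move=> chi [chiB nchi] f /IP[_ fq].
  have [[x chix]|] := character_dichotomy Bi (@fs_delta R G) chiB; last exact.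
  by case: nchi; exists x.
- split=> // f fB fI; apply/IP; split=> //; apply: quasinilpotent_closed => e.
  move=> /gt0_real_complex[d d0 ->].
  (* The norm ball of radius [d / 4] is contained in [D_d]. *)
  have [|g /IP[_ gq] fg] := fI (d / 4); first by rewrite divr_gt0.
  by exists g => //; exact: fs_norm_fsball.
- split.
  + move=> x _; split=> [a f g h e|f g h e|]; rewrite ?/point_eval ?e//.
    exists (SigSub (mem_set (Id x))); rewrite /point_eval/= eqxx.
    exact: oner_neq0.
  + move=> x y _ _ /(congr1 (fun chi => chi (SigSub (mem_set (Id x))))).
    rewrite /point_eval/= eqxx; case: (eqVneq y x) => // _ /eqP.
    by rewrite oner_eq0.
  (* All elements of [I] are quasinilpotent, so a character that is not a point evaluation would
     vanish identically. *)
  + move=> chi chiI; have [[x ->]|chi0] := character_dichotomy Ii Id chiI.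
      by exists x.
    have [_ _ [f]] := chiI; rewrite chi0 ?eqxx//.
    by have /IP[] := set_mem (valP f).
Qed.
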